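(* Let $\mathcal{G}$ and $\mathcal{F}$ be families of fully supported graphs with isomorphism-invariant augmented labeling schemes $\Psi$ and $\widetilde{\Psi}$, respectively. Suppose that $\mathcal{F}$ has a $\mathcal{G}$-magic decomposition. If OGJ with cost $c_\Psi$ detects and identifies isomorphism for $\mathcal{G}$, then OGJ with cost $c_{\widetilde{\Psi}}$ detects and identifies isomorphism for $\mathcal{F}$.
   Context: A graph is $G=(U,\alpha,\phi_G)$ with $U$ finite, $\alpha:U\times U\to[0,\infty)$ symmetric with total sum $1$ (a weight function), and $\phi_G$ a primary vertex label function; its marginal is $p(u)=\sum_{u'}\alpha(u,u')$, and $G$ is fully supported if $p>0$. An augmented labeling scheme assigns to each graph $G$ in a family a label function $\psi_G=(\phi_G,\phi'_G)$ (primary plus secondary label); it is isomorphism-invariant if $\psi_H\circ f=\psi_G$ for every isomorphism $f$ from $G$ to $H$ (a bijection preserving edge weights and primary labels). A weight joining of $\alpha$ (on $U$, marginal $p$) and $\beta$ (on $V$, marginal $q$) is a weight function $\gamma$ on $U\times V$ whose marginal $r_\gamma(u,v)=\sum_{(u',v')}\gamma((u,v),(u',v'))$ is a coupling of $p$ and $q$, and which satisfies $p(u)\sum_{\tilde v}\gamma((u,v),(u',\tilde v))=\alpha(u,u')r_\gamma(u,v)$ and $q(v)\sum_{\tilde u}\gamma((u,v),(\tilde u,v'))=\beta(v,v')r_\gamma(u,v)$ for all $u,u',v,v'$. With cost $c_\Psi(u,v)=\mathbb{I}(\psi_G(u)\neq\psi_H(v))$, the OGJ cost is $\rho_\Psi(G,H)=\min_\gamma\sum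 c_\Psi(u,v)r_\gamma(u,v)$ over weight joinings, with optimal set $\mathcal{J}^*_\Psi(\alpha,\beta)$. OGJ with cost $c_\Psi$ detects isomorphism for a family if for all $G,H$ in it, $\rho_\Psi(G,H)=0$ iff $G\cong H$; it identifies isomorphism if for all isomorphic $G,H$ in it, the extreme points of $\mathcal{J}^*_\Psi(\alpha,\beta)$ are exactly the zero-cost bijective weight joinings (those where each $u$ has a unique $v$ with $r_\gamma(u,v)>0$ and vice versa). A leaf $u$ of $G$ is a vertex with exactly one $u'\neq u$ such that $\alpha(u,u')>0$; $u'$ is its base $b(u)$. Gluing: given connected graphs $G_i=(U_i,\alpha_i,\phi_{G_i})$, $i=1,\dots,k$, and a finite set $M$ (all pairwise disjoint), subsets $L_i$ of leaves of $G_i$ with $U'_i=U_i\setminus L_i\neq\varnothing$, and maps $f_i:L_i\to M$ sending distinct leaves with the same base to distinct elements, define $\alpha'_i$ on $U=M\cup U'_1\cup\dots\cup U'_k$ as $\alpha_i$ on $U'_i$, with each leaf $v'\in L_i$ replaced by $f_i(v')$ (i.e. $\alpha'_i(b(v'),f_i(v'))=\alpha'_i(f_i(v'),b(v'))=\alpha_i(b(v'),v')$), and $0$ otherwise. $G=(U,\alpha,\phi_G)$ is a gluing of $G_1,\dots,G_k$ along $M$ if $\alpha=\tau+\sum_i\mu_i\alpha'_i$ for constants $\mu_i>0$ and some $\tau\ge0$ supported in $M\times M$. A family $\mathcal{F}$ with augmented scheme $\widetilde{\Psi}$ (labels in $\mathcal{L}_\mathcal{F}$) has a $\mathcal{G}$-magic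 decomposition (with $\mathcal{G}$'s scheme $\Psi$ having labels in $\mathcal{L}_\mathcal{G}$) if there is $\mathcal{L}^*\subset\mathcal{L}_\mathcal{F}$ such that every $G\in\mathcal{F}$ is a gluing of nonempty connected graphs $G_1,\dots,G_k\in\mathcal{G}$ along some $M_G\subset U$ with: (1) $\widetilde\psi_G(M_G)\subset\mathcal{L}^*$ and $\widetilde\psi_G(U\setminus M_G)\cap\mathcal{L}^*=\emptyset$; (2) $\widetilde\psi_G$ is injective on $M_G$; (3) there is $\eta:\mathcal{L}_\mathcal{F}\to\mathcal{L}_\mathcal{G}$ with $\psi_{G_i}(u)=\eta(\widetilde\psi_G(u))$ for $u\in U'_i$; (4) there is $\eta':\mathcal{L}_\mathcal{F}\times\mathcal{L}_\mathcal{F}\to\mathcal{L}_\mathcal{G}$ with $\psi_{G_i}(u)=\eta'(\widetilde\psi_G(f_i(u)),\widetilde\psi_G(b(u)))$ for $u\in L_i$; (5) there is $\omega:\mathcal{L}_\mathcal{F}\to[0,1]$ with $\omega(\widetilde\psi_G(u))=\mu_i$ for all $u\in U'_i$.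
   Formalization: Leaves that are glued must carry no loop (gluing discards leaf loops, and the claim fails if they are allowed), and η, η', ω are taken uniform over the family F rather than depending on G (otherwise the claim fails). *)

(* Defs.v *)
From HB Require Import structures.
From mathcomp Require Import all_boot all_order all_algebra.
From mathcomp Require Import boolp classical_sets functions reals.

Set Implicit Arguments.
Unset Strict Implicit.
Unset Printing Implicit Defensive.

Import Order.TTheory GRing.Theory Num.Theory.

Local Open Scope classical_set_scope.
Local Open Scope ring_scope.

Definition marginal (R : realType) (U : finType) (w : U -> U -> R) (u : U) : R :=
  \sum_(u' : U) w u u'.

Definition is_weight (R : realType) (U : finType) (w : U -> U -> R) : Prop :=
  [/\ forall u u', 0 <= w u u',
      forall u u', w u u' = w u' u
    & \sum_(u : U) marginal w u = 1].

(* Loops [0 < weight u u] are allowed.  The vertex set is nonempty since the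
   total weight is 1. *)
Record graph (R : realType) (P : Type) : Type := Graph {
  vertex :> finType;
  weight : vertex -> vertex -> R;
  primary : vertex -> P;
  weightP : is_weight weight }.

Definition graph_family (R : realType) (P : Type) := graph R P -> Prop.

Definition fully_supported (R : realType) (P : Type) (G : graph R P) : Prop :=
  forall u : G, 0 < marginal (@weight R P G) u.

Definition connected_graph (R : realType) (P : Type) (G : graph R P) : Prop :=
  forall u v : G, connect (fun x y : G => 0 < weight x y) u v.

Definition is_isomorphism (R : realType) (P : Type) (G H : graph R P)
    (f : G -> H) : Prop :=
  [/\ bijective f,
      forall u u' : G, weight (f u) (f u') = weight u u'
    & forall u : G, primary (f u) = primary u].

Definition isomorphic (R : realType) (P : Type) (G H : graph R P) : Prop :=
  exists f : G -> H, is_isomorphism f.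

(* A scheme is given by its secondary labels, on all graphs; only the values on
   the graphs of the family under consideration are ever used. *)
Definition scheme (R : realType) (P S : Type) : Type :=
  forall G : graph R P, G -> S.

Definition aug_label (R : realType) (P S : Type) (Psi : scheme R P S)
    (G : graph R P) (u : G) : P * S :=
  (primary u, Psi G u).

Definition iso_invariant (R : realType) (P S : Type)
    (F : graph_family R P) (Psi : scheme R P S) : Prop :=
  forall (G H : graph R P) (f : G -> H), F G -> F H -> is_isomorphism f ->
  forall u : G, aug_label Psi (f u) = aug_label Psi u.

Definition is_coupling (R : realType) (U V : finType) (p : U -> R) (q : V -> R)
    (r : U * V -> R) : Prop :=
  [/\ forall x, 0 <= r x,
      forall u, \sum_(v : V) r (u, v) = p u
    & forall v, \sum_(u : U) r (u, v) = q v].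

Definition weight_joining (R : realType) (U V : finType)
    (a : U -> U -> R) (b : V -> V -> R) (g : U * V -> U * V -> R) : Prop :=
  [/\ is_weight g,
      is_coupling (marginal a) (marginal b) (marginal g),
      forall u u' v, marginal a u * (\sum_(v' : V) g (u, v) (u', v')) =
                     a u u' * marginal g (u, v)
    & forall u v v', marginal b v * (\sum_(u' : U) g (u, v) (u', v')) =
                     b v v' * marginal g (u, v)].

Definition joinings (R : realType) (P : Type) (G H : graph R P) :
    set (G * H -> G * H -> R) :=
  [set g | weight_joining (@weight R P G) (@weight R P H) g].
Arguments joinings {R P} G H.

Section OGJ.
Context (R : realType) (P S : eqType) (Psi : scheme R P S).

Definition joining_cost (G H : graph R P) (g : G * H -> G * H -> R) : R :=
  \sum_(x : G * H)
    (aug_label Psi x.1 != aug_label Psi x.2)%:R * marginal g x.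

(* The infimum is a minimum: the set of weight joinings is a polytope,
   nonempty since it contains the product of the two weights. *)
Definition OGJ_cost (G H : graph R P) : R :=
  inf [set joining_cost g | g in joinings G H].

Definition optimal_joinings (G H : graph R P) : set (G * H -> G * H -> R) :=
  [set g | joinings G H g /\ joining_cost g = OGJ_cost G H].

End OGJ.
Arguments optimal_joinings {R P S} Psi G H.

Definition bijective_joining (R : realType) (U V : finType)
    (g : U * V -> U * V -> R) : Prop :=
  (forall u, exists! v, 0 < marginal g (u, v)) /\
  (forall v, exists! u, 0 < marginal g (u, v)).

Definition extreme_points (R : realType) (T : Type) (A : set (T -> T -> R)) :
    set (T -> T -> R) :=
  [set g | A g /\
     forall (g1 g2 : T -> T -> R) (t : R), A g1 -> A g2 -> 0 < t < 1 ->
     (forall x y, g x y = t * g1 x y + (1 - t) * g2 x y) ->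
     g1 = g /\ g2 = g].

Definition detects_isomorphism (R : realType) (P S : eqType)
    (F : graph_family R P) (Psi : scheme R P S) : Prop :=
  forall G H : graph R P, F G -> F H ->
  (OGJ_cost Psi G H = 0 <-> isomorphic G H).

Definition identifies_isomorphism (R : realType) (P S : eqType)
    (F : graph_family R P) (Psi : scheme R P S) : Prop :=
  forall G H : graph R P, F G -> F H -> isomorphic G H ->
  extreme_points (optimal_joinings Psi G H) =
  [set g | [/\ joinings G H g, joining_cost Psi g = 0 & bijective_joining g]].

(* Exactly one vertex [u'] satisfies [0 < weight u u'], and it differs from
   [u]: in particular a leaf carries no loop.  Gluing forgets the weight of a
   loop at a replaced leaf, so such loops cannot be recovered from the glued
   graph. *)
Definition is_leaf (R : realType) (P : Type) (G : graph R P) (u : G) : Prop :=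
  exists2 u' : G, u' != u & forall x : G, 0 < weight u x <-> x = u'.

(* For a leaf, its unique neighbour; a dummy value is used when there is none. *)
Definition base (R : realType) (P : Type) (G : graph R P) (u : G) : G :=
  odflt u [pick u' | (u' != u) && (0 < weight u u')].

(* [glued_part L e f w]: [w] is the weight function that agrees with that of [G]
   on the vertices outside [L], each leaf [l] in [L] being replaced by [f l].
   A vertex [u] outside [L] is identified with [e u]; the values of [e] on [L]
   and of [f] outside [L] are irrelevant. *)
Definition glued_part (R : realType) (P : Type) (G : graph R P) (U : finType)
    (L : {set G}) (e f : G -> U) (w : U -> U -> R) : Prop :=
  [/\ forall u u' : G, u \notin L -> u' \notin L ->
        w (e u) (e u') = weight u u',
      forall l : G, l \in L ->
        w (e (base l)) (f l) = weight (base l) l /\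
        w (f l) (e (base l)) = weight (base l) l
    & forall x y : U,
        ~ (exists u u' : G,
             [/\ u \notin L, u' \notin L, x = e u & y = e u']) ->
        ~ (exists l : G,
             l \in L /\ ((x = e (base l) /\ y = f l) \/
                         (x = f l /\ y = e (base l)))) ->
        w x y = 0].

(* [G] is a gluing of [Gs 0], ..., [Gs (k - 1)] along [M], the disjoint union of
   [M] and of the [Gs i] minus [L i] being identified with the vertices of [G]
   through the maps [e i].  The primary labels of [G] and of its pieces are not
   related by this definition. *)
Definition is_gluing (R : realType) (P Q : Type) (G : graph R P)
    (k : nat) (Gs : 'I_k -> graph R Q) (M : {set G})
    (L : forall i, {set Gs i}) (e f : forall i, Gs i -> G)
    (mu : 'I_k -> R) : Prop :=
  [/\ forall i, connected_graph (Gs i),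
      forall i,
        [/\ forall l, l \in L i -> is_leaf l,
            exists u : Gs i, u \notin L i,
            forall l, l \in L i -> f i l \in M
          & forall l l', l \in L i -> l' \in L i -> l != l' ->
              base l = base l' -> f i l != f i l'],
      set_bij [set w : {i : 'I_k & Gs i} | tagged w \notin L (tag w)]
              [set x : G | x \notin M]
              (fun w => e (tag w) (tagged w)),
      forall i, 0 < mu i
    & exists (tau : G -> G -> R) (part : 'I_k -> G -> G -> R),
        [/\ forall x y, 0 <= tau x y,
            forall x y, tau x y != 0 -> x \in M /\ y \in M,
            forall i, glued_part (L i) (e i) (f i) (part i)
          & forall x y, weight x y = tau x y + \sum_(i < k) mu i * part i x y]].

(* The set [Lstar] and the functions [eta], [eta'] and [omega] depend on the
   family only, not on [G]. *)
Definition has_magic_decomposition (R : realType) (P S Q T : Type)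
    (F : graph_family R P) (PsiF : scheme R P S)
    (FG : graph_family R Q) (PsiG : scheme R Q T) : Prop :=
  exists (Lstar : set (P * S)) (eta : P * S -> Q * T)
         (eta' : (P * S) * (P * S) -> Q * T) (omega : P * S -> R),
  (forall a, 0 <= omega a <= 1) /\
  forall G : graph R P, F G ->
  exists (k : nat) (Gs : 'I_k -> graph R Q) (M : {set G})
         (L : forall i, {set Gs i}) (e f : forall i, Gs i -> G)
         (mu : 'I_k -> R),
  [/\ (0 < k)%N,
      forall i, FG (Gs i),
      is_gluing M L e f mu
    & [/\ (forall x : G, x \in M -> Lstar (aug_label PsiF x)) /\
          (forall x : G, x \notin M -> ~ Lstar (aug_label PsiF x)),
          {in M &, injective (@aug_label R P S PsiF G)},
          forall i (u : Gs i), u \notin L i ->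
            aug_label PsiG u = eta (aug_label PsiF (e i u)),
          forall i (u : Gs i), u \in L i ->
            aug_label PsiG u =
            eta' (aug_label PsiF (f i u), aug_label PsiF (e i (base u)))
        & forall i (u : Gs i), u \notin L i ->
            omega (aug_label PsiF (e i u)) = mu i]].

(* Main.v *)
Require Import Defs.
From mathcomp Require Import all_boot all_order all_algebra.
From mathcomp Require Import boolp classical_sets functions reals.
From mathcomp Require Import ring zify.

(* Call a joining rigid when no nonzero solution of the homogeneous joining
   equations is supported in its support.  Zero-cost rigid joinings are the
   extreme points of the optimal set, and exist as soon as the cost is zero; so
   it suffices to show that a zero-cost rigid joining [g] of two graphs of the
   big family is bijective.

   As labels are injective on [M], [g] matches [M] with [N] bijectively, and an
   edge of [g] leaving a pair of pieces [(i, j)] lands in [M * N].  Hence the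
   restriction of [g] to [(i, j)] is, by connectivity, [c i j] times a zero-cost
   joining of these pieces.  A homogeneous perturbation of the restriction
   pushes forward to one of [g], so the restriction is rigid too, and bijective
   by the assumption on the small family.  Finally, a perturbation of the matrix
   [c] with zero row and column sums and supported in that of [c] also perturbs
   [g], so [c] is rigid; since the row sum [mu i] equals the column sum [nu j]
   when [c i j] is nonzero, [c] has one nonzero entry per row and column, as in
   Birkhoff's theorem. *)

Set Implicit Arguments.
Unset Strict Implicit.
Unset Printing Implicit Defensive.

Import Order.TTheory GRing.Theory Num.Theory.

Local Open Scope ring_scope.

(** * Rigid joinings *)

Lemma sum_pair (R : realType) (U V : finType) (F : U * V -> R) :
  \sum_x F x = \sum_u \sum_v F (u, v).
Proof. by rewrite pair_bigA /=; apply: eq_bigr => -[]. Qed.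

Section Kernels.
Variables (R : realType) (U V : finType).
Implicit Types (a : U -> U -> R) (b : V -> V -> R) (g d : U * V -> U * V -> R).

Definition flip g : V * U -> V * U -> R :=
  fun x y => g (x.2, x.1) (y.2, y.1).

Definition symmetric_kernel g := forall x y, g x y = g y x.

Definition left_eqs a (p : U -> R) g :=
  (forall u, \sum_v marginal g (u, v) = p u) /\
  (forall u u' v, marginal a u * (\sum_v' g (u, v) (u', v')) =
                  a u u' * marginal g (u, v)).

Lemma marginal_flip g u v : marginal (flip g) (v, u) = marginal g (u, v).
Proof.
rewrite /marginal [RHS](reindex (fun x : V * U => (x.2, x.1))) //.
by apply: onW_bij; exists (fun x : U * V => (x.2, x.1)) => -[].
Qed.

Lemma marginal_add (T : finType) (g d : T -> T -> R) t x :
  marginal (fun x y => g x y + t * d x y) x = marginal g x + t * marginal d x.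
Proof. by rewrite /marginal big_split /= mulr_sumr. Qed.

Lemma marginal_scale (T : finType) (g : T -> T -> R) t x :
  marginal (fun x y => t * g x y) x = t * marginal g x.
Proof. by rewrite /marginal mulr_sumr. Qed.

Lemma marginal_pair g u v :
  marginal g (u, v) = \sum_u' \sum_v' g (u, v) (u', v').
Proof. exact: sum_pair. Qed.

Lemma left_eqs_add a p p' p'' g d t :
  left_eqs a p g -> left_eqs a p' d -> (forall u, p'' u = p u + t * p' u) ->
  left_eqs a p'' (fun x y => g x y + t * d x y).
Proof.
move=> [g1 g2] [d1 d2] pE; split=> [u|u u' v].
  under eq_bigr do rewrite marginal_add.
  by rewrite big_split /= -mulr_sumr g1 d1 pE.
rewrite marginal_add big_split /= -mulr_sumr !mulrDr g2.
by rewrite mulrCA d2 mulrCA.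
Qed.

Lemma left_eqs_scale a p p' g t :
  left_eqs a p g -> (forall u, p' u = t * p u) ->
  left_eqs a p' (fun x y => t * g x y).
Proof.
move=> [g1 g2] pE; split=> [u|u u' v].
  under eq_bigr do rewrite marginal_scale.
  by rewrite -mulr_sumr g1 pE.
by rewrite marginal_scale -mulr_sumr mulrCA g2 mulrCA.
Qed.

End Kernels.

Lemma le_marginal (R : realType) (T : finType) (g : T -> T -> R) x y :
  (forall x y, 0 <= g x y) -> g x y <= marginal g x.
Proof.
by move=> g0; rewrite /marginal (bigD1 y) //= lerDl; apply: sumr_ge0.
Qed.

Lemma marginal_ge0 (R : realType) (T : finType) (g : T -> T -> R) x :
  (forall x y, 0 <= g x y) -> 0 <= marginal g x.
Proof. by move=> g0; apply: sumr_ge0. Qed.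

Lemma kernel_supp_marginal (R : realType) (T : finType) (g : T -> T -> R) x y :
  (forall x y, 0 <= g x y) -> marginal g x = 0 -> g x y = 0.
Proof.
by move=> g0 gx; apply/eqP; rewrite eq_le g0 andbT -gx le_marginal.
Qed.

Lemma marginal_supp (R : realType) (T : finType) (g d : T -> T -> R) x :
  (forall x y, 0 <= g x y) -> (forall x y, g x y = 0 -> d x y = 0) ->
  marginal g x = 0 -> marginal d x = 0.
Proof.
move=> g0 gd gx; apply: big1 => y _; apply: gd.
exact: kernel_supp_marginal.
Qed.

Section Polytope.
Variables (R : realType) (U V : finType).
Variables (a : U -> U -> R) (b : V -> V -> R).
Hypothesis aW : is_weight a.
Implicit Types g d : U * V -> U * V -> R.

(** The total weight 1 follows from the first marginal and [aW], so the conditions split into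
    nonnegativity, symmetry and two mirror halves. *)
Lemma weight_joiningP g :
  weight_joining a b g <->
  [/\ forall x y, 0 <= g x y, symmetric_kernel g,
      left_eqs a (marginal a) g & left_eqs b (marginal b) (flip g)].
Proof.
have fl (v : V) (v' : V) (u : U) :
    \sum_u' flip g (v, u) (v', u') = \sum_u' g (u, v) (u', v') by [].
split=> [[[g0 gs g1] [_ cu cv] tu tv]|[g0 gs [cu tu] [cv tv]]].
  split=> //; split=> // [v|v v' u].
    by rewrite -cv; under eq_bigr do rewrite marginal_flip.
  by rewrite marginal_flip fl tv.
have cE : forall v, \sum_u marginal g (u, v) = marginal b v.
  by move=> v; rewrite -cv; under [RHS]eq_bigr do rewrite marginal_flip.
split=> //.
- split=> //; have [_ _ <-] := aW.
  by rewrite sum_pair; apply: eq_bigr => u _; rewrite cu.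
- by split=> // x; apply: marginal_ge0.
- by move=> u v v'; rewrite -fl tv marginal_flip.
Qed.

Definition homogeneous d :=
  [/\ symmetric_kernel d, left_eqs a (fun=> 0) d
    & left_eqs b (fun=> 0) (flip d)].

Definition rigid g :=
  forall d, homogeneous d -> (forall x y, g x y = 0 -> d x y = 0) ->
  forall x y, d x y = 0.

Lemma homogeneous_scale d t :
  homogeneous d -> homogeneous (fun x y => t * d x y).
Proof.
move=> [ds da db]; split.
- by move=> x y; rewrite ds.
- by apply: (left_eqs_scale da) => u; rewrite mulr0.
- by apply: (left_eqs_scale db) => u; rewrite mulr0.
Qed.

Lemma homogeneous_sub g1 g2 :
  weight_joining a b g1 -> weight_joining a b g2 ->
  homogeneous (fun x y => g1 x y + -1 * g2 x y).
Proof.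
move=> /weight_joiningP[_ s1 a1 b1] /weight_joiningP[_ s2 a2 b2]; split.
- by move=> x y; rewrite s1 s2.
- by apply: (left_eqs_add a1 a2) => u; rewrite mulN1r subrr.
- by apply: (left_eqs_add b1 b2) => u; rewrite mulN1r subrr.
Qed.

Lemma joining_add g d t :
  weight_joining a b g -> homogeneous d ->
  (forall x y, 0 <= g x y + t * d x y) ->
  weight_joining a b (fun x y => g x y + t * d x y).
Proof.
move=> /weight_joiningP[_ s1 a1 b1] [s2 a2 b2] ge0; apply/weight_joiningP; split=> //.
- by move=> x y; rewrite s1 s2.
- by apply: (left_eqs_add a1 a2) => u; rewrite mulr0 addr0.
- by apply: (left_eqs_add b1 b2) => u; rewrite mulr0 addr0.
Qed.

Lemma homogeneous_total d : homogeneous d -> \sum_x marginal d x = 0.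
Proof.
move=> [_ [da _] _].
by rewrite sum_pair; apply: big1 => u _.
Qed.

(** A homogeneous kernel has total mass zero, so it would vanish if it were nonnegative. *)
Lemma homogeneous_neg d x y :
  homogeneous d -> d x y != 0 -> exists x' y', d x' y' < 0.
Proof.
move=> hd dxy; apply: contrapT => noneg.
have d0 x' y' : 0 <= d x' y'.
  by rewrite leNgt; apply/negP => dn; apply: noneg; exists x', y'.
have m0 : marginal d x = 0.
  have /eqP := homogeneous_total hd.
  rewrite psumr_eq0 => [|z _]; last exact: marginal_ge0.
  by move=> /allP/(_ x (mem_index_enum _)) /eqP.
by rewrite (kernel_supp_marginal _ d0 m0) eqxx in dxy.
Qed.

End Polytope.

(** Ratio test of the simplex method: [t] is the least [g x / - d x] over the entries with
    [d x < 0], and the minimizing entry vanishes. *)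
Lemma nonneg_ray (R : realType) (T : finType) (g d : T -> R) z :
  (forall x, 0 <= g x) -> (forall x, g x = 0 -> d x = 0) -> d z < 0 ->
  exists t, [/\ 0 < t, forall x, 0 <= g x + t * d x
    & exists y, g y != 0 /\ g y + t * d y = 0].
Proof.
move=> g0 gd dz.
have [y dy ymin] := arg_minP (fun x => g x / - d x) (P := fun x => d x < 0) dz.
have gpos x : d x < 0 -> 0 < g x.
  move=> dx; rewrite lt_def g0 andbT; apply/eqP => /gd dx0.
  by rewrite dx0 ltxx in dx.
exists (g y / - d y); split.
- by rewrite divr_gt0 ?gpos ?oppr_gt0.
- move=> x; have [dx|dx] := leP 0 (d x).
    by rewrite addr_ge0 // mulr_ge0 // divr_ge0 // oppr_ge0 ltW.
  have := ymin x dx.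
  by rewrite ler_pdivlMr ?oppr_gt0 // mulrN lerNl -subr_ge0 opprK addrC.
- exists y; split; first by rewrite gt_eqF ?gpos.
  by rewrite invrN mulrN mulNr divfK ?subrr // lt_eqF.
Qed.

(** * Extreme points of the polytope of joinings *)

Section Extremal.
Variables (R : realType) (U V : finType).
Variables (a : U -> U -> R) (b : V -> V -> R).
Hypothesis aW : is_weight a.
Implicit Types g d : U * V -> U * V -> R.

Lemma joining_ray g d x y :
  weight_joining a b g -> homogeneous a b d ->
  (forall x y, g x y = 0 -> d x y = 0) -> d x y != 0 ->
  exists t, [/\ 0 < t, weight_joining a b (fun x y => g x y + t * d x y)
    & exists x' y', g x' y' != 0 /\ g x' y' + t * d x' y' = 0].
Proof.
move=> gJ hd gd dxy; have [x0 [y0 d0]] := homogeneous_neg hd dxy.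
have [g0 _ _ _] := (weight_joiningP b aW g).1 gJ.
have [|||t [t0 tp [[x1 y1] tz]]] :=
  @nonneg_ray R _ (fun z => g z.1 z.2) (fun z => d z.1 z.2) (x0, y0) => //=.
  by move=> z; apply: gd.
exists t; split=> //; last by exists x1, y1.
by apply: joining_add => // x' y'; apply: (tp (x', y')).
Qed.

(* A kernel of minimal support is rigid: otherwise it can be moved along a
   homogeneous direction until an entry vanishes. *)
Lemma exists_rigid_le (w : U * V -> R) g : weight_joining a b g ->
  exists g', [/\ weight_joining a b g', rigid a b g'
    & \sum_x w x * marginal g' x <= \sum_x w x * marginal g x].
Proof.
have [n] := ubnP #|[set z : (U * V) * (U * V) | g z.1 z.2 != 0]|.
elim: n g => // n IH g gn gJ.
have [gr|/existsNP[d /not_implyP[hd /not_implyP[gd]]]] := EM (rigid a b g).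
  by exists g.
move=> /existsNP[x /existsNP[y /eqP dxy]].
(* Up to replacing [d] by its opposite, moving along [d] does not increase the cost. *)
wlog dw : d hd gd dxy / \sum_x w x * marginal d x <= 0.
  move=> wl; have [|dw] := leP (\sum_x w x * marginal d x) 0; first exact: wl.
  apply: (wl (fun x y => -1 * d x y)).
  - exact: homogeneous_scale.
  - by move=> x' y' /gd ->; rewrite mulr0.
  - by rewrite mulN1r oppr_eq0.
  - under eq_bigr do rewrite marginal_scale mulN1r mulrN.
    by rewrite sumrN oppr_le0 ltW.
have [t [t0 tJ [x1 [y1 [g1 g1t]]]]] := joining_ray gJ hd gd dxy.
have [|g' [g'J g'r g'w]] := IH (fun x y => g x y + t * d x y) _ tJ.
  rewrite ltnS in gn; apply: leq_trans gn; apply: proper_card; apply/properP; split.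
    apply/fintype.subsetP => z; rewrite !inE; apply: contraNneq => gz.
    by rewrite gz (gd _ _ gz) mulr0 addr0.
  by exists (x1, y1); rewrite !inE //= g1t eqxx.
exists g'; split=> //; apply: (le_trans g'w).
under eq_bigr do rewrite marginal_add mulrDr mulrCA.
by rewrite big_split /= -mulr_sumr gerDl pmulr_rle0.
Qed.

(** The difference [g1 - g2] is homogeneous and supported in the support of [g1]. *)
Lemma rigid_supp_inj g1 g2 :
  weight_joining a b g1 -> weight_joining a b g2 -> rigid a b g1 ->
  (forall x y, g1 x y = 0 -> g2 x y = 0) -> g1 = g2.
Proof.
move=> J1 J2 r1 s12; apply/funext => x; apply/funext => y.
apply/eqP; rewrite -subr_eq0 -mulN1r; apply/eqP.
apply: (r1 _ (homogeneous_sub aW J1 J2)) => x' y' g0.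
by rewrite g0 s12 // mulr0 addr0.
Qed.

(* Rigid joinings are determined by their support, hence finite in number. *)
Lemma exists_rigid_zero (w : U * V -> R) :
  (forall x, 0 <= w x) ->
  (exists g, weight_joining a b g) ->
  inf [set \sum_x w x * marginal g x | g in [set g | weight_joining a b g]]%classic = 0 ->
  exists g, [/\ weight_joining a b g, rigid a b g
    & \sum_x w x * marginal g x = 0].
Proof.
move=> w0 [g0 J0] inf0; apply: contrapT => none.
pose cost g := \sum_x w x * marginal g x.
have cost0 g : weight_joining a b g -> 0 <= cost g.
  move=> /(weight_joiningP b aW)[gp _ _ _]; apply: sumr_ge0 => x _.
  by rewrite mulr_ge0 ?marginal_ge0.
pose supp g := [set z : (U * V) * (U * V) | g z.1 z.2 != 0].
(* At most one rigid joining has support [s], and its cost is nonzero by [none]. The value 1 is a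
   default for the supports without any. *)
have epsP (s : {set (U * V) * (U * V)}) : exists eps : R, 0 < eps /\
    forall g, weight_joining a b g -> rigid a b g -> supp g = s -> eps <= cost g.
  have [[g [gJ gr gs]]|no] :=
    EM (exists g, [/\ weight_joining a b g, rigid a b g & supp g = s]).
    exists (cost g); split.
      rewrite lt_def cost0 // andbT; apply/eqP => gc.
      by apply: none; exists g.
    move=> g' g'J g'r g's; rewrite (rigid_supp_inj gJ g'J gr) // => x y gxy.
    have: (x, y) \notin supp g by rewrite inE /= gxy eqxx.
    by rewrite gs -g's inE /= negbK => /eqP.
  by exists 1; split=> // g gJ gr gs; case: no; exists g.
have [eps epsE] := choice epsP.
pose m := \big[Num.min/1]_s eps s.
have m0 : 0 < m.
  by apply: (big_ind (fun x => 0 < x)) => // [x y x0 y0|s _];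
    [rewrite lt_min x0|have [] := epsE s].
(* The infimum being zero, some joining costs less than [m]; by [exists_rigid_le] so does a rigid
   one, against the choice of [m]. *)
have [|_ [g gJ <-]] := inf_adherent m0 (E :=
    [set cost g | g in [set g | weight_joining a b g]]%classic).
  by split; [exists (cost g0), g0|exists 0 => _ [g gJ <-]; apply: cost0].
rewrite inf0 add0r ltNge => /negP; apply.
have [g' [g'J g'r g'c]] := exists_rigid_le w gJ.
apply: le_trans g'c; apply: le_trans ((epsE (supp g')).2 _ g'J g'r erefl).
exact: bigmin_le_cond.
Qed.

(** The second hypothesis is a face property: joinings reached from [g] by moves within its support
    stay in [A]. Along a homogeneous direction supported in [g] one can move both ways, which puts
    [g] inside a segment of [A]. Conversely, the ends of a segment around [g] are supported in [g],
    hence equal to it by rigidity. *)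
Lemma extreme_rigid (A : set (U * V -> U * V -> R)) g :
  (A `<=` [set h | weight_joining a b h])%classic ->
  (forall d t, weight_joining a b (fun x y => g x y + t * d x y) ->
     (forall x y, g x y = 0 -> d x y = 0) -> A (fun x y => g x y + t * d x y)) ->
  A g ->
  extreme_points A g <-> rigid a b g.
Proof.
move=> AJ Amove Ag; have gJ := AJ _ Ag; split=> [[_ ext] d hd gd x y|gr].
  apply: contrapT => /eqP dxy.
  have [t [t0 tJ _]] := joining_ray gJ hd gd dxy.
  pose d' x y := -1 * d x y.
  have hd' : homogeneous a b d' by exact: homogeneous_scale.
  have gd' x' y' : g x' y' = 0 -> d' x' y' = 0.
    by rewrite /d' => /gd ->; rewrite mulr0.
  have [|s [s0 sJ _]] := @joining_ray g d' x y gJ hd' gd'.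
    by rewrite /d' mulN1r oppr_eq0.
  have st0 : s + t != 0 by rewrite gt_eqF ?addr_gt0.
  (* The displacements [t * d] and [- s * d] cancel with the weights [s / (s + t)] and
     [t / (s + t)]. *)
  have [|x' y'|E _] := ext _ _ (s / (s + t)) (Amove _ _ tJ gd) (Amove _ _ sJ gd').
  - by rewrite divr_gt0 ?addr_gt0 //= ltr_pdivrMr ?addr_gt0 // mul1r ltrDl.
  - by rewrite /d'; field.
  have /eqP := congr1 (fun h => h x y) E.
  by rewrite -subr_eq0 addrAC subrr add0r mulf_eq0 (negPf dxy) gt_eqF.
split=> // g1 g2 t A1 A2 /andP[t0 t1] gE.
have J1 := AJ _ A1; have J2 := AJ _ A2.
have [p1 _ _ _] := (weight_joiningP b aW g1).1 J1.
have [p2 _ _ _] := (weight_joiningP b aW g2).1 J2.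
have z12 x y : g x y = 0 -> g1 x y = 0 /\ g2 x y = 0.
  move=> /eqP; rewrite gE paddr_eq0 ?mulr_ge0 ?subr_ge0 // ?(ltW t0) ?(ltW t1) //.
  by rewrite !mulf_eq0 subr_eq0 (gt_eqF t0) (gt_eqF t1) /= => /andP[/eqP-> /eqP->].
by split; apply/esym; apply: rigid_supp_inj => // x y /z12[].
Qed.

End Extremal.

(** * Bijective joinings *)

Section GraphSupport.
Variables (R : realType) (U V : finType) (a : U -> U -> R).
Hypothesis a_supp : forall u, 0 < marginal a u.
Variables (f : U -> V) (g : U * V -> U * V -> R).
Hypotheses (g0 : forall x y, 0 <= g x y) (gs : symmetric_kernel g)
  (gf : forall u v, v != f u -> marginal g (u, v) = 0).

Lemma graph_supp_out d u v u' v' :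
  (forall x y, g x y = 0 -> d x y = 0 :> R) ->
  (v != f u) || (v' != f u') -> d (u, v) (u', v') = 0.
Proof.
move=> gd /orP[/gf r0|/gf r0]; apply: gd; last rewrite gs;
  exact: kernel_supp_marginal.
Qed.

Lemma graph_supp_marginal d p u : (forall x y, g x y = 0 -> d x y = 0 :> R) ->
  left_eqs a p d -> marginal d (u, f u) = p u.
Proof.
move=> gd [<- _]; rewrite (bigD1 (f u)) //= big1 ?addr0 // => v vf.
by apply: (marginal_supp g0 gd); apply: gf.
Qed.

(** Only [v' = f u'] contributes to the transition equation out of [(u, f u)], which thus gives the
    entry explicitly. The case [p = 0] yields rigidity, and [d = g] the values of [g]. *)
Lemma graph_supp_value d p u u' : (forall x y, g x y = 0 -> d x y = 0 :> R) ->
  left_eqs a p d ->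
  marginal a u * d (u, f u) (u', f u') = a u u' * p u.
Proof.
move=> gd da; rewrite -(graph_supp_marginal u gd da) -da.2; congr (_ * _).
rewrite (bigD1 (f u')) //= big1 ?addr0 // => v' vf.
by apply: graph_supp_out => //; rewrite vf orbT.
Qed.

Lemma graph_supp_joining u u' : left_eqs a (marginal a) g ->
  g (u, f u) (u', f u') = a u u'.
Proof.
move=> ga; apply: (mulfI (lt0r_neq0 (a_supp u))).
by rewrite (graph_supp_value _ _ _ ga) // mulrC.
Qed.

Lemma graph_supp_rigid b : rigid a b g.
Proof.
move=> d [ds da _] gd [u v] [u' v'].
have [vf|vf] := eqVneq v (f u); last by apply: graph_supp_out => //; rewrite vf.
have [vf'|vf'] := eqVneq v' (f u'); last first.
  by apply: graph_supp_out => //; rewrite vf' orbT.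
apply: (mulfI (lt0r_neq0 (a_supp u))); rewrite vf vf'.
by rewrite (graph_supp_value _ _ gd da) !mulr0.
Qed.

End GraphSupport.

(** The image of [a] under [u |-> (u, f u)]: the joining carried by an isomorphism [f]. *)
Definition graph_kernel (R : realType) (U V : finType) (a : U -> U -> R)
    (f : U -> V) (x y : U * V) : R :=
  if (x.2 == f x.1) && (y.2 == f y.1) then a x.1 y.1 else 0.

Lemma graph_kernel_left (R : realType) (U V : finType) (a : U -> U -> R)
    (f : U -> V) : left_eqs a (marginal a) (graph_kernel a f).
Proof.
have S u v u' : \sum_v' graph_kernel a f (u, v) (u', v') =
                if v == f u then a u u' else 0.
  rewrite (bigD1 (f u')) //= big1 => [|v' /negPf vf].
    by rewrite addr0 /graph_kernel /= eqxx andbT.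
  by rewrite /graph_kernel /= vf andbF.
have M u v : marginal (graph_kernel a f) (u, v) =
             if v == f u then marginal a u else 0.
  rewrite marginal_pair; under eq_bigr do rewrite S.
  by case: eqP => // _; rewrite big1.
split=> [u|u u' v].
  by under eq_bigr do rewrite M; rewrite -big_mkcond big_pred1_eq.
by rewrite M S; case: eqP => _; rewrite ?mulr0 // mulrC.
Qed.

(** Shows that the set of joinings is nonempty, so that the infimum defining the cost is
    meaningful. *)
Lemma product_joining (R : realType) (U V : finType)
    (a : U -> U -> R) (b : V -> V -> R) :
  is_weight a -> is_weight b ->
  weight_joining a b (fun x y => a x.1 y.1 * b x.2 y.2).
Proof.
move=> aW bW.
suff L (U' V' : finType) (a' : U' -> U' -> R) (b' : V' -> V' -> R) :
    is_weight b' ->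
    left_eqs a' (marginal a') (fun x y => a' x.1 y.1 * b' x.2 y.2).
  have [a0 as_ _] := aW; have [b0 bs _] := bW.
  apply/weight_joiningP => //; split.
  - by move=> x y; rewrite mulr_ge0.
  - by move=> x y; rewrite as_ bs.
  - exact: L.
  - have [L1 L2] := L _ _ b a aW.
    have -> : flip (fun x y => a x.1 y.1 * b x.2 y.2) =
              (fun x y : V * U => b x.1 y.1 * a x.2 y.2).
      by apply/funext => x; apply/funext => y; rewrite /flip mulrC.
    by split.
move=> [_ _ b1].
have M u v : marginal (fun x y : U' * V' => a' x.1 y.1 * b' x.2 y.2) (u, v) =
    marginal a' u * marginal b' v.
  rewrite marginal_pair /= mulr_suml; apply: eq_bigr => u' _.
  by rewrite -mulr_sumr.
split=> [u|u u' v].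
  by under eq_bigr do rewrite M; rewrite -mulr_sumr b1 mulr1.
by rewrite M /= -mulr_sumr mulrCA.
Qed.

(** * Zero-cost joinings of labelled graphs *)

Section Graphs.
Variables (R : realType) (P S : eqType) (Psi : scheme R P S).
Implicit Types G H : graph R P.

Lemma zero_costP G H (g : G * H -> G * H -> R) : (forall x y, 0 <= g x y) ->
  joining_cost Psi g = 0 <->
  forall x, marginal g x != 0 -> aug_label Psi x.1 = aug_label Psi x.2.
Proof.
move=> g0; rewrite /joining_cost; split=> [/eqP c0 x gx|lab].
  move: c0; rewrite psumr_eq0 => [/allP/(_ x (mem_index_enum _))|y _].
    by rewrite mulf_eq0 (negPf gx) orbF pnatr_eq0 eqb0 negbK => /eqP.
  by rewrite mulr_ge0 ?marginal_ge0.
apply: big1 => x _; have [->|/lab ->] := eqVneq (marginal g x) 0.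
  by rewrite mulr0.
by rewrite eqxx mul0r.
Qed.

Lemma joiningP G H (g : G * H -> G * H -> R) :
  joinings G H g <->
  [/\ forall x y, 0 <= g x y, symmetric_kernel g,
      left_eqs (@weight R P G) (marginal (@weight R P G)) g
    & left_eqs (@weight R P H) (marginal (@weight R P H)) (flip g)].
Proof. exact: weight_joiningP (weightP G) _. Qed.

Lemma joining_cost_ge0 G H (g : G * H -> G * H -> R) :
  joinings G H g -> 0 <= joining_cost Psi g.
Proof.
move=> /joiningP[g0 _ _ _]; apply: sumr_ge0 => x _.
by rewrite mulr_ge0 ?marginal_ge0.
Qed.

Lemma OGJ_cost_eq0 G H (g : G * H -> G * H -> R) :
  joinings G H g -> joining_cost Psi g = 0 -> OGJ_cost Psi G H = 0.
Proof.
move=> gJ g0; apply/eqP; rewrite eq_le; apply/andP; split.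
  rewrite -[X in _ <= X]g0; apply: ge_inf; last by exists g.
  by exists 0 => _ [h hJ <-]; apply: joining_cost_ge0.
apply: lb_le_inf; first by exists (joining_cost Psi g), g.
by move=> _ [h hJ <-]; apply: joining_cost_ge0.
Qed.

Lemma OGJ_cost_rigid G H : OGJ_cost Psi G H = 0 ->
  exists g : G * H -> G * H -> R, [/\ joinings G H g,
    rigid (@weight R P G) (@weight R P H) g & joining_cost Psi g = 0].
Proof.
apply: exists_rigid_zero => //; first exact: weightP.
exists (fun x y => weight x.1 y.1 * weight x.2 y.2).
exact: product_joining (weightP G) (weightP H).
Qed.

(** Zero cost depends only on the support of the marginal, so moves within the support of [g]
    preserve it, which is the face property of [extreme_rigid]. *)
Lemma extreme_optimal_rigid G H (g : G * H -> G * H -> R) :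
  OGJ_cost Psi G H = 0 -> joinings G H g -> joining_cost Psi g = 0 ->
  extreme_points (optimal_joinings Psi G H) g <->
  rigid (@weight R P G) (@weight R P H) g.
Proof.
move=> c0 gJ g0; apply: extreme_rigid; first exact: weightP.
- by move=> h [].
- move=> d t tJ gd; split=> //; rewrite c0.
  have [tp _ _ _] := (joiningP _).1 tJ; have [gp _ _ _] := (joiningP _).1 gJ.
  apply/zero_costP => // x mx; apply: (zero_costP gp).1 => //.
  apply: contraNneq mx => gx; apply/eqP.
  by apply: (marginal_supp gp) => // y z gyz; rewrite gyz gd // mulr0 addr0.
- by split; rewrite ?g0 ?c0.
Qed.

Lemma bijective_joining_graph G H (g : G * H -> G * H -> R) :
  (forall x y, 0 <= g x y) -> bijective_joining g ->
  exists (f : G -> H) (h : H -> G), [/\ cancel f h, cancel h f,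
    forall u v, v != f u -> marginal g (u, v) = 0
  & forall v u, u != h v -> marginal (flip g) (v, u) = 0].
Proof.
move=> g0 [/choice[f fP] /choice[h hP]].
have r0 x : marginal g x != 0 -> 0 < marginal g x.
  by move=> x0; rewrite lt_def x0 marginal_ge0.
exists f, h; split.
- by move=> u; apply: (hP (f u)).2; apply: (fP u).1.
- by move=> v; apply: (fP (h v)).2; apply: (hP v).1.
- move=> u v; apply: contraNeq => /r0 uv.
  by apply/eqP/esym; apply: (fP u).2.
- move=> v u; rewrite marginal_flip; apply: contraNeq => /r0 uv.
  by apply/eqP/esym; apply: (hP v).2.
Qed.

Lemma bijective_joining_rigid G H (g : G * H -> G * H -> R) :
  fully_supported G -> joinings G H g -> bijective_joining g ->
  rigid (@weight R P G) (@weight R P H) g.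
Proof.
move=> Gs /joiningP[g0 gs _ _] /(bijective_joining_graph g0)[f [h [_ _ gf _]]].
exact: graph_supp_rigid gf _.
Qed.

(** On the graph of the underlying bijection, the entries of [g] equal the weights of [G] by the
    left equations and those of [H] by the right ones. Each [(u, f u)] has nonzero mass, so zero
    cost gives equal labels. *)
Lemma bijective_joining_iso G H (g : G * H -> G * H -> R) :
  fully_supported G -> fully_supported H ->
  joinings G H g -> joining_cost Psi g = 0 -> bijective_joining g ->
  isomorphic G H.
Proof.
move=> Gs Hs gJ; have [g0 gs ga gb] := (joiningP _).1 gJ.
move=> /(zero_costP g0).1 lab.
move=> /(bijective_joining_graph g0)[f [h [fK hK gf gh]]].
exists f; split; first by exists h.
- move=> u u'.
  rewrite -(graph_supp_joining Gs g0 gs gf _ _ ga).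
  by rewrite -[LHS](graph_supp_joining Hs _ _ gh _ _ gb) /flip /= ?fK //.
- move=> u; have : marginal g (u, f u) != 0.
    by rewrite (graph_supp_marginal g0 gf _ _ ga) // gt_eqF ?Gs.
  by move=> /lab /(congr1 fst) /= ->.
Qed.

Lemma iso_zero_cost G H (f : G -> H) : is_isomorphism f ->
  (forall u, aug_label Psi (f u) = aug_label Psi u) ->
  exists g, joinings G H g /\ joining_cost Psi g = 0.
Proof.
move=> [[h fK hK] fw _] lab.
pose g := graph_kernel (@weight R P G) f.
have [a0 as_ _] := weightP G.
have g0 x y : 0 <= g x y by rewrite /g /graph_kernel; case: ifP.
exists g; split.
  apply/joiningP; split=> //.
  - by move=> x y; rewrite /g /graph_kernel andbC as_.
  - exact: graph_kernel_left.
  - have -> : flip g = graph_kernel (@weight R P H) h.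
      apply/funext => -[v u]; apply/funext => -[v' u'].
      rewrite /flip /g /graph_kernel /=.
      rewrite (eq_sym u) (eq_sym u') !(can2_eq hK fK).
      case: andP => // -[/eqP-> /eqP->].
      by rewrite fw.
    exact: graph_kernel_left.
apply/zero_costP => // -[u v] /= m; rewrite -lab.
suff -> : v = f u by [].
apply: contraNeq m => vf; apply/eqP; apply: big1 => -[u' v'] _.
by rewrite /g /graph_kernel /= (negPf vf).
Qed.

End Graphs.

(** * Rigid matrices *)

(** A homogeneous linear system with more unknowns, indexed by [T], than equations, indexed by
    [K]. *)
Lemma exists_kernel (F : fieldType) (T K : finType) (A : T -> K -> F) :
  (#|K| < #|T|)%N ->
  exists x : T -> F, (exists t, x t != 0) /\ forall k, \sum_t x t * A t k = 0.
Proof.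
move=> KT.
pose M := \matrix_(i < #|T|, j < #|K|) A (enum_val i) (enum_val j).
have /rowV0Pn[y /sub_kermxP yM /rV0Pn[j yj]] : kermx M != 0.
  rewrite -mxrank_eq0 mxrank_ker subn_eq0 -ltnNge.
  exact: leq_ltn_trans (rank_leq_col M) KT.
exists (fun t => y 0 (enum_rank t)); split.
  by exists (enum_val j); rewrite enum_valK.
move=> k; have /matrixP/(_ 0 (enum_rank k)) := yM; rewrite !mxE => yk.
rewrite (reindex (fun i : 'I_#|T| => enum_val i)) /=; last exact/onW_bij/enum_val_bij.
by rewrite -[RHS]yk; apply: eq_bigr => i _; rewrite enum_valK !mxE enum_rankK.
Qed.

(** Every nonempty fibre of [h] on [E] has at least two elements. *)
Lemma card_imset_double (T K : finType) (h : T -> K) (E : {set T}) :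
  (forall x, x \in E -> exists y, [/\ y \in E, y != x & h y = h x]) ->
  (#|h @: E| * 2 <= #|E|)%N.
Proof.
move=> E2; rewrite -[X in (_ <= X)%N]sum1_card.
rewrite (partition_big h (mem (h @: E))) /= => [|x xE]; last exact: imset_f.
rewrite -sum_nat_const; apply: leq_sum => _ /imsetP[x xE ->].
have [y [yE yx yh]] := E2 x xE.
rewrite sum1_card; apply/card_gt1P; exists x, y.
by split; rewrite 1?eq_sym // ?yx // -topredE /= ?xE ?yE ?yh eqxx.
Qed.

Section RigidMatrix.
Variables (R : realType) (I J : finType) (c : I -> J -> R).
Variables (mu : I -> R) (nu : J -> R).
Hypotheses (c0 : forall i j, 0 <= c i j)
  (cmu : forall i, \sum_j c i j = mu i) (cnu : forall j, \sum_i c i j = nu j)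
  (mu_nu : forall i j, c i j != 0 -> mu i = nu j).
Hypothesis c_rigid : forall X : I -> J -> R,
  (forall i, \sum_j X i j = 0) -> (forall j, \sum_i X i j = 0) ->
  (forall i j, c i j = 0 -> X i j = 0) -> forall i j, X i j = 0.

(* Every row and every column meeting the set [E] of entries that are neither
   zero nor a full row sum meets it twice, so [E] has at least as many elements
   as there are such rows and columns.  One of these linear constraints is
   redundant, hence a nonzero perturbation supported in [E]. *)
Lemma rigid_matrix_row_inj i j j' : c i j != 0 -> c i j' != 0 -> j = j'.
Proof.
move=> cj cj'; apply: contrapT => /eqP jj'.
pose E := [set x : I * J | 0 < c x.1 x.2 < mu x.1].
have cpos k l : c k l != 0 -> 0 < c k l by move=> ckl; rewrite lt_def ckl c0.
have EP k l l' : c k l != 0 -> c k l' != 0 -> l != l' -> (k, l) \in E.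
  move=> kl kl' ll'; rewrite inE /= cpos //= -cmu (bigD1 l) //=.
  rewrite ltrDl (bigD1 l') 1?eq_sym //= ltr_pwDl ?cpos //.
  exact: sumr_ge0.
have E1 x : x \in E -> exists y, [/\ y \in E, y != x & y.1 = x.1].
  case: x => k l; rewrite inE /= => /andP[kl klm].
  have [/existsP[l' /andP[ll' kl']]|/existsPn no] :=
    boolP [exists l', (l' != l) && (c k l' != 0)].
    exists (k, l'); split=> //; last by rewrite xpair_eqE eqxx.
    by apply: (EP _ _ l) => //; rewrite gt_eqF.
  move: klm; rewrite -cmu (bigD1 l) //= big1 ?addr0 ?ltxx // => l' ll'.
  by apply/eqP; move: (no l'); rewrite ll' /= negbK.
have E2 x : x \in E -> exists y, [/\ y \in E, y != x & y.2 = x.2].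
  case: x => k l; rewrite inE /= => /andP[kl].
  (* Row and column sums agree at a nonzero entry, so an entry below its row sum is also below its
     column sum. *)
  rewrite (mu_nu (lt0r_neq0 kl)) => klm.
  have [/existsP[k' /andP[kk' kl']]|/existsPn no] :=
    boolP [exists k', (k' != k) && (c k' l != 0)].
    exists (k', l); split=> //; last by rewrite xpair_eqE eqxx andbT.
    rewrite inE /= cpos //= (mu_nu kl') -cnu (bigD1 k) //= (bigD1 k') //=.
    rewrite addrA addrAC ltrDr ltr_pwDl //; exact: sumr_ge0.
  move: klm; rewrite -cnu (bigD1 k) //= big1 ?addr0 ?ltxx // => k' kk'.
  by apply/eqP; move: (no k'); rewrite kk' /= negbK.
(* The column [j] meets [E], so dropping it makes the number of equations strictly smaller than
   [#|E|]. *)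
pose I' := [set x.1 | x in E]; pose J' := [set x.2 | x in E] :\ j.
have jE : (i, j) \in E by apply: (EP _ _ j').
have jJ : j \in [set x.2 | x in E] by apply/imsetP; exists (i, j).
pose T := {x : I * J | x \in E}.
pose K := ({k | k \in I'} + {l | l \in J'})%type.
have [|x [[t0 xt0] xK]] := @exists_kernel R T K
  (fun t k => match k with
              | inl k => ((val t).1 == val k)%:R
              | inr l => ((val t).2 == val l)%:R end).
  have cE (W : finType) (B : {set W}) : #|{: {x | x \in B}}| = #|B|.
    by rewrite card_sig; apply: eq_card.
  rewrite card_sum !cE.
  have := card_imset_double E1; have := card_imset_double E2.
  rewrite -/I' (cardsD1 j [set x.2 | x in E]) jJ -/J'.
  by lia.
pose X k l : R := \sum_t x t * (val t == (k, l))%:R.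
have Xrow k : \sum_l X k l = \sum_t x t * ((val t).1 == k)%:R.
  rewrite exchange_big /=; apply: eq_bigr => t _; rewrite -mulr_sumr.
  congr (_ * _); rewrite (bigD1 (val t).2) //= big1 => [|l /negPf ll].
    by rewrite addr0; case: (val t) => u v /=; rewrite xpair_eqE eqxx andbT.
  by case: (val t) ll => u v /=; rewrite xpair_eqE [v == l]eq_sym => ->; rewrite andbF.
have Xcol l : \sum_k X k l = \sum_t x t * ((val t).2 == l)%:R.
  rewrite exchange_big /=; apply: eq_bigr => t _; rewrite -mulr_sumr.
  congr (_ * _); rewrite (bigD1 (val t).1) //= big1 => [|k /negPf ll].
    by rewrite addr0; case: (val t) => u v /=; rewrite xpair_eqE eqxx.
  by case: (val t) ll => u v /=; rewrite xpair_eqE [u == k]eq_sym => ->.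
have Xrow0 k : \sum_l X k l = 0.
  rewrite Xrow; have [kI|kI] := boolP (k \in I').
    exact: (xK (inl (Sub k kI))).
  apply: big1 => t _; case: eqP => [tk|]; last by rewrite mulr0.
  by case/imsetP: kI; exists (val t) => //; apply: valP.
have Xcol0' l : l != j -> \sum_k X k l = 0.
  move=> lj; rewrite Xcol; have [lJ|lJ] := boolP (l \in J').
    exact: (xK (inr (Sub l lJ))).
  apply: big1 => t _; case: eqP => [tl|]; last by rewrite mulr0.
  case/negP: lJ; rewrite !inE lj; apply/imsetP.
  by exists (val t) => //; apply: valP.
(* The dropped equation: the row sums vanish, hence so does the total, to which the other columns
   contribute nothing. *)
have Xcol0 l : \sum_k X k l = 0.
  have [->|] := eqVneq l j; last exact: Xcol0'.
  have : \sum_l \sum_k X k l = 0 by rewrite exchange_big big1.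
  by rewrite (bigD1 j) //= [X in _ + X]big1 ?addr0.
have Xsupp k l : c k l = 0 -> X k l = 0.
  move=> ckl; apply: big1 => t _; case: eqP => [tkl|]; last by rewrite mulr0.
  by have := valP t; rewrite tkl inE /= ckl ltxx.
have /eqP := c_rigid Xrow0 Xcol0 Xsupp (val t0).1 (val t0).2.
rewrite /X -surjective_pairing (bigD1 t0) //= eqxx mulr1 big1.
  by rewrite addr0 (negPf xt0).
by move=> t tt0; rewrite (inj_eq val_inj) (negPf tt0) mulr0.
Qed.

End RigidMatrix.

(* [s / marginal a] takes the same value at both ends of every edge. *)
Lemma connected_proportional (R : realType) (U : finType) (a w : U -> U -> R)
    (s : U -> R) :
  is_weight a -> (forall u, 0 < marginal a u) ->
  (forall u v, connect (fun x y => 0 < a x y) u v) ->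
  (forall u v, w u v = w v u) ->
  (forall u v, marginal a u * w u v = a u v * s u) ->
  forall u, s u = (\sum_v s v) * marginal a u.
Proof.
move=> [_ as_ a1] p0 conn ws wE u.
have sE v : s v = s u / marginal a u * marginal a v.
  pose A := [pred v | s v == s u / marginal a u * marginal a v].
  have cl : closed (fun x y => 0 < a x y) A.
    move=> x y axy; rewrite !inE.
    have -> : s x = w x y / a x y * marginal a x.
      apply: (mulfI (lt0r_neq0 axy)); rewrite -wE.
      by field; rewrite gt_eqF.
    have -> : s y = w x y / a x y * marginal a y.
      apply: (mulfI (lt0r_neq0 axy)); rewrite [in LHS]as_ -wE ws.
      by field; rewrite gt_eqF.
    by rewrite !(inj_eq (mulIf (lt0r_neq0 (p0 _)))).
  have := closed_connect cl (conn u v).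
  by rewrite !inE divfK ?lt0r_neq0 // eqxx => /esym/eqP.
by rewrite (eq_bigr _ (fun v _ => sE v)) -mulr_sumr a1 mulr1 divfK ?lt0r_neq0.
Qed.

(** * Restriction of a joining to a pair of pieces *)

(* The map [pi] sends a piece, with weight [a1], into the glued graph, with
   weight [a]: each leaf of [L] goes to the element of [M] that replaces it. *)
Record piece (R : realType) (U U1 : finType) (a : U -> U -> R) (M : {set U})
    (a1 : U1 -> U1 -> R) (L : {set U1}) (pi : U1 -> U) (mu : R) : Prop := Piece {
  piece_weight : is_weight a1;
  piece_supp : forall u, 0 < marginal a1 u;
  piece_conn : forall u v, connect (fun x y => 0 < a1 x y) u v;
  piece_mu : 0 < mu;
  piece_in : forall u, (pi u \in M) = (u \in L);
  piece_inj : forall u v, u \notin L -> pi u = pi v -> u = v;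
  piece_cov : forall u x, u \notin L ->
    a (pi u) x = mu * \sum_(v | pi v == x) a1 u v;
  piece_loc_inj : forall u v v',
    0 < a1 u v -> 0 < a1 u v' -> pi v = pi v' -> v = v';
  piece_leaf : forall l, l \in L ->
    exists2 b, b \notin L & forall x, (0 < a1 l x) = (x == b);
  piece_inner : exists u, u \notin L }.

(** What is kept of a zero-cost joining once labels are forgotten: it pairs [M] with [N] only, and
    each of their elements with a single one. The notion is stable under [flip], so the mirror
    statements come for free. *)
Record compatible (R : realType) (U V : finType) (a : U -> U -> R)
    (b : V -> V -> R) (M : {set U}) (N : {set V}) (g : U * V -> U * V -> R) :
    Prop := Compatible {
  cp_supp : forall u, 0 < marginal a u;
  cp_supp_flip : forall v, 0 < marginal b v;
  cp_weight : forall u u', 0 <= a u u';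
  cp_weight_flip : forall v v', 0 <= b v v';
  cp_ge0 : forall x y, 0 <= g x y;
  cp_sym : symmetric_kernel g;
  cp_left : left_eqs a (marginal a) g;
  cp_right : left_eqs b (marginal b) (flip g);
  cp_match : forall u v, marginal g (u, v) != 0 -> (u \in M) = (v \in N);
  cp_uniq : forall u v v', u \in M -> marginal g (u, v) != 0 ->
    marginal g (u, v') != 0 -> v = v';
  cp_uniq_flip : forall v u u', v \in N -> marginal (flip g) (v, u) != 0 ->
    marginal (flip g) (v, u') != 0 -> u = u' }.

Lemma flipK (R : realType) (U V : finType) (g : U * V -> U * V -> R) :
  flip (flip g) = g.
Proof. by apply/funext => -[u v]; apply/funext => -[u' v']. Qed.

Lemma compatible_flip (R : realType) (U V : finType) (a : U -> U -> R)
    (b : V -> V -> R) (M : {set U}) (N : {set V}) (g : U * V -> U * V -> R) :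
  compatible a b M N g -> compatible b a N M (flip g).
Proof.
case=> pa pb a0 b0 g0 gs ga gb gm gu gu'; split=> //.
- by move=> x y; exact: g0.
- by move=> x y; exact: gs.
- by rewrite flipK.
- by move=> v u; rewrite marginal_flip => /gm.
- by rewrite flipK.
Qed.

Lemma compatible_edge (R : realType) (U V : finType) (a : U -> U -> R)
    (b : V -> V -> R) (M : {set U}) (N : {set V}) (g : U * V -> U * V -> R)
    u v u' v' :
  compatible a b M N g -> a u u' = 0 -> g (u, v) (u', v') = 0.
Proof.
move=> C a0; have /eqP := (cp_left C).2 u u' v.
rewrite a0 mul0r mulf_eq0 gt_eqF ?(cp_supp C) //=.
rewrite psumr_eq0 => [/allP/(_ v' (mem_index_enum _))/eqP //|? _].
exact: cp_ge0 C _ _.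
Qed.

Lemma sum_fibers (R : realType) (T T' : finType) (P : T -> T') (F : T -> R) :
  \sum_X \sum_(z | P z == X) F z = \sum_z F z.
Proof. by rewrite [RHS](partition_big P xpredT). Qed.

Section Piece.
Variables (R : realType) (U U1 : finType) (a : U -> U -> R) (M : {set U}).
Variables (a1 : U1 -> U1 -> R) (L : {set U1}) (pi : U1 -> U) (mu : R).
Hypothesis A : piece a M a1 L pi mu.

Lemma piece_ge0 u v : 0 <= a1 u v.
Proof. by case: (piece_weight A). Qed.

Lemma piece_sym u v : a1 u v = a1 v u.
Proof. by case: (piece_weight A). Qed.

Lemma piece_edge0 u v : (0 < a1 u v) = false -> a1 u v = 0.
Proof. by rewrite lt_def piece_ge0 andbT => /negbFE/eqP. Qed.

Lemma piece_marginal u : u \notin L -> marginal a (pi u) = mu * marginal a1 u.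
Proof.
move=> uL; rewrite /marginal; under eq_bigr do rewrite (piece_cov A) //.
by rewrite -mulr_sumr sum_fibers.
Qed.

Lemma piece_edge u v : u \notin L -> 0 < a1 u v ->
  a (pi u) (pi v) = mu * a1 u v.
Proof.
move=> uL uv; rewrite (piece_cov A) //; congr (_ * _).
rewrite (bigD1 v) //= big1 ?addr0 // => w /andP[/eqP wv wv'].
apply/piece_edge0/negbTE; apply: contra wv' => uw.
by apply/eqP; apply: piece_loc_inj A _ _ _ uw uv wv.
Qed.

Lemma piece_fiber_sum u (h : U -> R) : u \notin L ->
  (forall x, a (pi u) x = 0 -> h x = 0) ->
  \sum_(v | 0 < a1 u v) h (pi v) = \sum_x h x.
Proof.
move=> uL h0; rewrite (partition_big pi xpredT) //=; apply: eq_bigr => x _.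
have [ax|ax] := eqVneq (a (pi u) x) 0.
  by rewrite h0 // big1 // => v /andP[_ /eqP->]; apply: h0.
have [v /andP[uv /eqP vx]] : exists v, (0 < a1 u v) && (pi v == x).
  apply/existsP; apply: contraNT ax => /existsPn no.
  rewrite (piece_cov A) // big1 ?mulr0 // => v vx.
  by apply/piece_edge0/negbTE; move: (no v); rewrite vx andbT.
rewrite (bigD1 v) /= ?uv ?vx ?eqxx // big1 ?addr0 //.
move=> w /andP[/andP[uw /eqP wx]] /eqP[].
by apply: piece_loc_inj A _ _ _ uw uv _; rewrite wx.
Qed.

Lemma piece_leaf_nbr l u : l \in L -> 0 < a1 l u -> u \notin L.
Proof. by move=> /(piece_leaf A)[b bL ->] /eqP ->. Qed.

End Piece.

(** Leaves with different bases may have the same image in [M]; the test on the edges of the pieces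
    keeps an edge of [g] from being counted at each of them. *)
Definition restriction (R : realType) (U V U1 V1 : finType)
    (a1 : U1 -> U1 -> R) (b1 : V1 -> V1 -> R) (pi : U1 -> U) (rho : V1 -> V)
    (g : U * V -> U * V -> R) (z z' : U1 * V1) : R :=
  if (0 < a1 z.1 z'.1) && (0 < b1 z.2 z'.2)
  then g (pi z.1, rho z.2) (pi z'.1, rho z'.2) else 0.

Lemma flip_restriction (R : realType) (U V U1 V1 : finType)
    (a1 : U1 -> U1 -> R) (b1 : V1 -> V1 -> R) (pi : U1 -> U) (rho : V1 -> V)
    (g : U * V -> U * V -> R) :
  flip (restriction a1 b1 pi rho g) = restriction b1 a1 rho pi (flip g).
Proof.
by apply/funext => z; apply/funext => z'; rewrite /flip /restriction andbC.
Qed.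

Definition mass (R : realType) (U V : finType) (g : U * V -> U * V -> R) : R :=
  \sum_u \sum_v marginal g (u, v).

Lemma mass_flip (R : realType) (U V : finType) (g : U * V -> U * V -> R) :
  mass (flip g) = mass g.
Proof.
rewrite /mass exchange_big /=; apply: eq_bigr => u _; apply: eq_bigr => v _.
exact: marginal_flip.
Qed.

Section Restriction.
Variables (R : realType) (U U1 : finType) (a : U -> U -> R) (M : {set U}).
Variables (a1 : U1 -> U1 -> R) (L : {set U1}) (pi : U1 -> U) (mu : R).
Hypothesis A : piece a M a1 L pi mu.
Variables (V V1 : finType) (b : V -> V -> R) (N : {set V}).
Variables (b1 : V1 -> V1 -> R) (K : {set V1}) (rho : V1 -> V) (nu : R).
Hypothesis B : piece b N b1 K rho nu.
Variable g : U * V -> U * V -> R.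
Hypothesis C : compatible a b M N g.

Let res := restriction a1 b1 pi rho g.

Lemma restriction_ge0 z z' : 0 <= res z z'.
Proof. by rewrite /res /restriction; case: ifP => // _; apply: cp_ge0 C _ _. Qed.

Lemma restriction_sym : symmetric_kernel res.
Proof.
move=> z z'; rewrite /res /restriction (piece_sym A z.1) (piece_sym B z.2).
by rewrite (cp_sym C).
Qed.

Lemma restriction_mixed u v z' : (u \in L) != (v \in K) -> res (u, v) z' = 0.
Proof.
move=> uv; rewrite /res /restriction; case: ifP => //= _.
apply: kernel_supp_marginal; first exact: cp_ge0 C.
apply/eqP; apply: contraNT uv => /(cp_match C).
by rewrite (piece_in A) (piece_in B) => ->.
Qed.

Lemma restriction_sum_inner u v u' : u \notin L -> v \notin K ->
  \sum_v' res (u, v) (u', v') =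
  if 0 < a1 u u' then \sum_y g (pi u, rho v) (pi u', y) else 0.
Proof.
move=> uL vK; rewrite /res /restriction /=.
case: ifP => uu /=; last by rewrite big1.
rewrite -big_mkcond /=.
apply: (piece_fiber_sum B (h := fun y => g (pi u, rho v) (pi u', y))) => //.
move=> y by0; exact: (compatible_edge (pi u) (pi u') (compatible_flip C) by0).
Qed.

(** At an inner pair, an edge of [g] projects to edges of both glued graphs, and these lift uniquely
    to the two pieces. *)
Lemma restriction_marginal_inner u v : u \notin L -> v \notin K ->
  marginal res (u, v) = marginal g (pi u, rho v).
Proof.
move=> uL vK; rewrite !marginal_pair.
under eq_bigr do rewrite restriction_sum_inner //.
rewrite -big_mkcond /=.
apply: (piece_fiber_sum A (h := fun x => \sum_y g (pi u, rho v) (x, y))) => //.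
by move=> x ax; apply: big1 => y _; apply: compatible_edge C ax.
Qed.

Lemma restriction_leaf u v bu bv u' v' :
  (forall x, (0 < a1 u x) = (x == bu)) -> (forall y, (0 < b1 v y) = (y == bv)) ->
  res (u, v) (u', v') =
  if (u' == bu) && (v' == bv) then g (pi u, rho v) (pi bu, rho bv) else 0.
Proof.
move=> ub vb; rewrite /res /restriction /= ub vb.
by case: andP => // -[/eqP-> /eqP->].
Qed.

Lemma restriction_left_trans u u' v :
  marginal a1 u * (\sum_v' res (u, v) (u', v')) =
  a1 u u' * marginal res (u, v).
Proof.
have [uvK|uvK] := eqVneq (u \in L) (v \in K); last first.
  rewrite big1 => [|v' _]; last exact: restriction_mixed.
  rewrite /marginal [X in _ = _ * X]big1 => [|z _]; last exact: restriction_mixed.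
  by rewrite !mulr0.
(* At a pair of leaves, the only possible edge of the restriction goes to the pair of their
   neighbours. *)
have [uL|uL] := boolP (u \in L).
  have [bu _ ub] := piece_leaf A uL.
  have [bv _ vb] : exists2 b, b \notin K & forall x, (0 < b1 v x) = (x == b).
    by apply: (piece_leaf B); rewrite -uvK.
  have S u2 : \sum_v' res (u, v) (u2, v') =
      if u2 == bu then g (pi u, rho v) (pi bu, rho bv) else 0.
    under eq_bigr do rewrite (restriction_leaf _ _ ub vb).
    case: eqP => _ /=; last by rewrite big1.
    by rewrite -big_mkcond big_pred1_eq.
  have -> : marginal res (u, v) = g (pi u, rho v) (pi bu, rho bv).
    rewrite marginal_pair; under eq_bigr do rewrite S.
    by rewrite -big_mkcond big_pred1_eq.
  have -> : marginal a1 u = a1 u bu.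
    rewrite /marginal (bigD1 bu) //= big1 ?addr0 // => x /negPf xb.
    by apply: (piece_edge0 A); rewrite ub.
  rewrite S; case: eqP => [->//|/eqP/negPf ne].
  by rewrite [a1 u u'](piece_edge0 A) ?ub // mulr0 mul0r.
have vK : v \notin K by rewrite -uvK.
rewrite restriction_sum_inner // restriction_marginal_inner //.
case: ifP => uu; last by rewrite (piece_edge0 A uu) mulr0 mul0r.
(* Multiplication by [mu] turns this into the transition equation of [g] in the glued graph. *)
apply: (mulfI (lt0r_neq0 (piece_mu A))); rewrite !mulrA.
by rewrite -(piece_marginal A) // -(piece_edge A) // (cp_left C).2.
Qed.

(** Summed over [v], the transition equation is the hypothesis of [connected_proportional], with [w]
    the projection of the restriction to the piece. *)
Lemma restriction_left : left_eqs a1 (fun u => mass res * marginal a1 u) res.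
Proof.
split; last exact: restriction_left_trans.
pose w u u' := \sum_v \sum_v' res (u, v) (u', v').
apply: (connected_proportional (w := w) (piece_weight A) (piece_supp A)
  (piece_conn A)) => u u'.
  rewrite /w exchange_big; apply: eq_bigr => v _; apply: eq_bigr => v' _.
  exact: restriction_sym.
rewrite /w !mulr_sumr; apply: eq_bigr => v _.
by rewrite -restriction_left_trans mulr_sumr.
Qed.

End Restriction.

Section PieceJoining.
Variables (R : realType) (U U1 : finType) (a : U -> U -> R) (M : {set U}).
Variables (a1 : U1 -> U1 -> R) (L : {set U1}) (pi : U1 -> U) (mu : R).
Hypothesis A : piece a M a1 L pi mu.
Variables (V V1 : finType) (b : V -> V -> R) (N : {set V}).
Variables (b1 : V1 -> V1 -> R) (K : {set V1}) (rho : V1 -> V) (nu : R).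
Hypothesis B : piece b N b1 K rho nu.
Variable g : U * V -> U * V -> R.
Hypothesis C : compatible a b M N g.

Let res := restriction a1 b1 pi rho g.

Lemma restriction_right :
  left_eqs b1 (fun v => mass res * marginal b1 v) (flip res).
Proof.
rewrite -mass_flip /res flip_restriction.
exact: (restriction_left B A (compatible_flip C)).
Qed.

Lemma mass_restriction_ge0 : 0 <= mass res.
Proof.
apply: sumr_ge0 => u _; apply: sumr_ge0 => v _; apply: marginal_ge0.
exact: restriction_ge0 C.
Qed.

Lemma restriction_joining : 0 < mass res ->
  weight_joining a1 b1 (fun z z' => (mass res)^-1 * res z z').
Proof.
move=> c0; apply/weight_joiningP; first exact: piece_weight A.
split.
- by move=> z z'; rewrite mulr_ge0 ?invr_ge0 ?(ltW c0) //; apply: restriction_ge0 C _ _.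
- by move=> z z'; congr (_ * _); apply: (restriction_sym A B C).
- apply: (left_eqs_scale (restriction_left A B C)) => u.
  by rewrite mulKf ?lt0r_neq0.
- apply: (left_eqs_scale restriction_right) => u.
  by rewrite mulKf ?lt0r_neq0.
Qed.

(** The first marginal is positive at a vertex outside [L], and such a vertex is never paired with
    one in [K]. Scalars attached to a pair of pieces are later read off at such an inner pair. *)
Lemma restriction_mass_inner : 0 < mass res ->
  exists u v, [/\ u \notin L, v \notin K & marginal g (pi u, rho v) != 0].
Proof.
move=> c0; have [u uL] := piece_inner A; exists u.
apply: contrapT => no.
have : 0 < mass res * marginal a1 u by rewrite mulr_gt0 ?(piece_supp A).
rewrite -(restriction_left A B C).1 big1 ?ltxx // => v _.
have [vK|vK] := boolP (v \in K).
  apply: big1 => z _; apply: (restriction_mixed A B C).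
  by rewrite (negPf uL) vK.
rewrite (restriction_marginal_inner A B C) //.
by apply/eqP; apply: contraT => r0; case: no; exists v.
Qed.

End PieceJoining.

(** * Rigidity of the restrictions *)

Definition pushforward (R : realType) (U V U1 V1 : finType) (pi : U1 -> U)
    (rho : V1 -> V) (d : U1 * V1 -> U1 * V1 -> R) (x y : U * V) : R :=
  \sum_(z | (pi z.1, rho z.2) == x) \sum_(z' | (pi z'.1, rho z'.2) == y) d z z'.

Lemma sum_swap (R : realType) (U V : finType) (p : pred (U * V)) F :
  \sum_(z | p z) F z = \sum_(z : V * U | p (z.2, z.1)) F (z.2, z.1) :> R.
Proof.
apply: (reindex (fun z : V * U => (z.2, z.1))).
by apply: onW_bij; exists (fun z : U * V => (z.2, z.1)) => -[].
Qed.

Lemma flip_pushforward (R : realType) (U V U1 V1 : finType) (pi : U1 -> U)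
    (rho : V1 -> V) (d : U1 * V1 -> U1 * V1 -> R) :
  flip (pushforward pi rho d) = pushforward rho pi (flip d).
Proof.
apply/funext => -[v u]; apply/funext => -[v' u'].
rewrite /flip /pushforward sum_swap /=.
apply: eq_big => [z|z _]; first by rewrite !xpair_eqE andbC.
rewrite sum_swap /=; apply: eq_big => [z'|//].
by rewrite !xpair_eqE andbC.
Qed.

Lemma sum_pair_fiber (R : realType) (U V U1 V1 : finType) (pi : U1 -> U)
    (rho : V1 -> V) (F : U1 * V1 -> R) x y :
  \sum_(z | (pi z.1, rho z.2) == (x, y)) F z =
  \sum_(u | pi u == x) \sum_(v | rho v == y) F (u, v).
Proof.
rewrite pair_big /=; apply: eq_big => [z|[] //]; exact: xpair_eqE.
Qed.

Lemma marginal_pushforward (R : realType) (U V U1 V1 : finType) (pi : U1 -> U)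
    (rho : V1 -> V) (d : U1 * V1 -> U1 * V1 -> R) x y :
  marginal (pushforward pi rho d) (x, y) =
  \sum_(u | pi u == x) \sum_(v | rho v == y) marginal d (u, v).
Proof.
rewrite -sum_pair_fiber /marginal /pushforward exchange_big /=.
apply: eq_bigr => z _; exact: (sum_fibers (fun z => (pi z.1, rho z.2)) (d z)).
Qed.

Section PieceRigid.
Variables (R : realType) (U U1 : finType) (a : U -> U -> R) (M : {set U}).
Variables (a1 : U1 -> U1 -> R) (L : {set U1}) (pi : U1 -> U) (mu : R).
Hypothesis A : piece a M a1 L pi mu.
Variables (V V1 : finType) (b : V -> V -> R) (N : {set V}).
Variables (b1 : V1 -> V1 -> R) (K : {set V1}) (rho : V1 -> V) (nu : R).
Hypothesis B : piece b N b1 K rho nu.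
Variable g : U * V -> U * V -> R.
Hypothesis C : compatible a b M N g.

Let res := restriction a1 b1 pi rho g.

Lemma restriction_supp_marginal d u v :
  (forall z z', res z z' = 0 -> d z z' = 0 :> R) ->
  marginal g (pi u, rho v) = 0 -> marginal d (u, v) = 0.
Proof.
move=> resd m0; apply: big1 => z _; apply: resd.
rewrite /res /restriction; case: ifP => // _.
exact: kernel_supp_marginal (cp_ge0 C) m0.
Qed.

(** For [x] outside [M], the transition probabilities out of a preimage are those out of [x], as
    [mu] cancels. For [x] in [M], the leaves over [x] may have different neighbours, but each
    carries zero mass [T]. *)
Lemma pushforward_left d :
  left_eqs a1 (fun=> 0) d -> (forall z z', res z z' = 0 -> d z z' = 0) ->
  left_eqs a (fun=> 0) (pushforward pi rho d).
Proof.
move=> [d1 d2] resd; split=> [x|x x' y].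
  under eq_bigr do rewrite marginal_pushforward.
  rewrite exchange_big big1 //= => u _.
  by rewrite (sum_fibers rho (fun v => marginal d (u, v))).
pose T u := \sum_(v | rho v == y) marginal d (u, v).
(* In a replaced leaf [u], all the mass of [d] over [u] lies over the unique
   element of [N] matched with [pi u], so the marginal condition kills it. *)
have T0 u : u \in L -> T u = 0.
  move=> uL; have uM : pi u \in M by rewrite (piece_in A).
  have [ry|ry] := eqVneq (marginal g (pi u, y)) 0.
    by apply: big1 => v /eqP vy; apply: restriction_supp_marginal; rewrite ?vy.
  rewrite -[RHS](d1 u) [RHS](bigID (fun v => rho v == y)) /=.
  rewrite [X in _ = _ + X]big1 ?addr0 // => v vy.
  apply: restriction_supp_marginal => //; apply: contraNeq vy => rv.
  by apply/eqP; apply: (cp_uniq C uM rv ry).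
have S : \sum_y' pushforward pi rho d (x, y) (x', y') =
    \sum_(u | pi u == x) (\sum_(u' | pi u' == x') a1 u u') / marginal a1 u * T u.
  rewrite /pushforward exchange_big /= sum_pair_fiber; apply: eq_bigr => u _.
  rewrite /T mulr_sumr; apply: eq_bigr => v _.
  under eq_bigr do rewrite sum_pair_fiber.
  rewrite exchange_big /= mulrAC -mulrA mulr_suml; apply: eq_bigr => u' _.
  rewrite (sum_fibers rho (fun v' => d (u, v) (u', v'))).
  apply: (mulfI (lt0r_neq0 (piece_supp A u))); rewrite d2.
  by field; rewrite gt_eqF ?(piece_supp A).
rewrite S marginal_pushforward !mulr_sumr; apply: eq_bigr => u /eqP <-.
rewrite -/(T u); have [uL|uL] := boolP (u \in L); first by rewrite T0 // !mulr0.
rewrite (piece_marginal A) // (piece_cov A) //.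
by field; rewrite gt_eqF ?(piece_supp A).
Qed.

Lemma pushforward_supp (d : U1 * V1 -> U1 * V1 -> R) :
  (forall z z', res z z' = 0 -> d z z' = 0) ->
  forall x y, g x y = 0 -> pushforward pi rho d x y = 0.
Proof.
move=> resd x y gxy; apply: big1 => z /eqP zx; apply: big1 => z' /eqP zy.
by apply: resd; rewrite /res /restriction zx zy gxy if_same.
Qed.

(** An inner pair is the only preimage of its image, and its neighbours have distinct images, so
    nothing cancels. *)
Lemma pushforward_inner (d : U1 * V1 -> U1 * V1 -> R) u v u' v' :
  (forall z z', res z z' = 0 -> d z z' = 0) ->
  u \notin L -> v \notin K -> 0 < a1 u u' -> 0 < b1 v v' ->
  pushforward pi rho d (pi u, rho v) (pi u', rho v') = d (u, v) (u', v').
Proof.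
move=> resd uL vK uu vv.
rewrite /pushforward (bigD1 (u, v)) //= [X in _ + X]big1 ?addr0; last first.
  move=> [w t] /= /andP[/eqP[/esym wu /esym tv]].
  by rewrite -(piece_inj A uL wu) -(piece_inj B vK tv) eqxx.
rewrite (bigD1 (u', v')) //= big1 ?addr0 // => -[w t] /= /andP[/eqP[wu tv] ne].
apply: resd; rewrite /res /restriction /=; case: ifP => // /andP[uw vt].
by rewrite (piece_loc_inj A uw uu wu) (piece_loc_inj B vt vv tv) eqxx in ne.
Qed.

Lemma restriction_edge u v u' v' : res (u, v) (u', v') != 0 ->
  [/\ 0 < a1 u u', 0 < b1 v v' & (v \in K) = (u \in L)].
Proof.
move=> rz; have /andP[uu vv] : (0 < a1 u u') && (0 < b1 v v').
  by move: rz; rewrite /res /restriction /=; case: ifP; rewrite ?eqxx.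
split=> //; apply/esym/eqP; apply: contraNT rz => uvK; apply/eqP.
exact: (restriction_mixed A B C).
Qed.

End PieceRigid.

Section PieceRigidity.
Variables (R : realType) (U U1 : finType) (a : U -> U -> R) (M : {set U}).
Variables (a1 : U1 -> U1 -> R) (L : {set U1}) (pi : U1 -> U) (mu : R).
Hypothesis A : piece a M a1 L pi mu.
Variables (V V1 : finType) (b : V -> V -> R) (N : {set V}).
Variables (b1 : V1 -> V1 -> R) (K : {set V1}) (rho : V1 -> V) (nu : R).
Hypothesis B : piece b N b1 K rho nu.
Variable g : U * V -> U * V -> R.
Hypothesis C : compatible a b M N g.

Let res := restriction a1 b1 pi rho g.

(** The pushforward of a perturbation [d] vanishes by rigidity of [g], which kills the entries of
    [d] at inner pairs. An entry at a leaf is, by symmetry, an entry at its neighbour, which is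
    inner. *)
Lemma restriction_rigid : rigid a b g -> rigid a1 b1 res.
Proof.
move=> gr d [ds da db] resd.
have push0 x y : pushforward pi rho d x y = 0.
  apply: gr; last exact: (pushforward_supp resd).
  split.
  - move=> {}x {}y; rewrite /pushforward exchange_big /=.
    by apply: eq_bigr => z _; apply: eq_bigr => z' _; rewrite ds.
  - exact: (pushforward_left A C da resd).
  - rewrite flip_pushforward; apply: (pushforward_left B (compatible_flip C) db).
    by move=> z z'; rewrite -flip_restriction => /resd.
have inner u v u' v' : u \notin L -> d (u, v) (u', v') = 0.
  move=> uL; apply: contrapT => /eqP dz.
  have /(restriction_edge A B C)[uu vv uvK] : res (u, v) (u', v') != 0.
    by apply: contraNneq dz => /resd ->.
  by move/eqP: dz; apply; rewrite -(pushforward_inner A B resd) // uvK.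
move=> [u v] [u' v']; have [uL|/inner//] := boolP (u \in L).
apply: contrapT => /eqP dz.
have /(restriction_edge A B C)[uu vv _] : res (u, v) (u', v') != 0.
  by apply: contraNneq dz => /resd ->.
by rewrite ds inner ?eqxx // ?(piece_leaf_nbr A uL) in dz.
Qed.

End PieceRigidity.

(** * The matrix of masses of a decomposed joining *)

(* [idx x] is the piece containing [x]; its values on [M] are irrelevant. *)
Record decomposition (R : realType) (U : finType) (a : U -> U -> R)
    (M : {set U}) (I : finType) (W : I -> finType) (a1 : forall i, W i -> W i -> R)
    (L : forall i, {set W i}) (pi : forall i, W i -> U) (mu : I -> R)
    (idx : U -> I) : Prop := Decomposition {
  dec_piece : forall i, piece a M (a1 i) (L i) (pi i) (mu i);
  dec_idx : forall i u, u \notin L i -> idx (pi i u) = i;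
  dec_surj : forall x, x \notin M ->
    exists2 u, u \notin L (idx x) & pi (idx x) u = x }.

(** Multiplies [g] by the density [Y i j] on the edges over the pieces [i] and [j]. An edge starting
    in [M] takes its density from its other end; edges with both ends in [M] get zero. *)
Definition perturbation (R : realType) (U V I J : finType) (M : {set U})
    (idx : U -> I) (jdx : V -> J) (Y : I -> J -> R) (g : U * V -> U * V -> R)
    (z z' : U * V) : R :=
  (if z.1 \notin M then Y (idx z.1) (jdx z.2) else
   if z'.1 \notin M then Y (idx z'.1) (jdx z'.2) else 0) * g z z'.

Section Perturbation.
Variables (R : realType) (U V I J : finType) (a : U -> U -> R) (b : V -> V -> R).
Variables (M : {set U}) (N : {set V}) (g : U * V -> U * V -> R).
Hypothesis C : compatible a b M N g.
Variables (idx : U -> I) (jdx : V -> J) (Y : I -> J -> R).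

Lemma compatible_marginal u v z : g (u, v) z != 0 -> marginal g (u, v) != 0.
Proof.
by apply: contraNneq => r0; apply/eqP; apply: (kernel_supp_marginal _ (cp_ge0 C)).
Qed.

Lemma flip_perturbation :
  flip (perturbation M idx jdx Y g) =
  perturbation N jdx idx (fun j i => Y i j) (flip g).
Proof.
apply/funext => -[v u]; apply/funext => -[v' u'].
rewrite /flip /perturbation /=.
have [->|gz] := eqVneq (g (u, v) (u', v')) 0; first by rewrite !mulr0.
rewrite (cp_match C (compatible_marginal gz)).
by rewrite (cp_sym C) in gz; rewrite (cp_match C (compatible_marginal gz)).
Qed.

Lemma perturbation_left :
  (forall x, x \notin M ->
     \sum_y Y (idx x) (jdx y) * marginal g (x, y) = 0) ->
  left_eqs a (fun=> 0) (perturbation M idx jdx Y g).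
Proof.
move=> Y0.
have S0 x y x' : x \in M ->
    \sum_y' perturbation M idx jdx Y g (x, y) (x', y') = 0.
  move=> xM; rewrite /perturbation /= xM /=.
  have [_|xM'] /= := boolP (x' \in M).
    by apply: big1 => y' _; rewrite mul0r.
  have [r0|r0] := eqVneq (marginal g (x, y)) 0.
    by apply: big1 => y' _; rewrite (kernel_supp_marginal _ (cp_ge0 C)) ?mulr0.
  (* Since [x] is in [M], its only partner is [y], and the transition equation from [(x', y')] to
     [x] reduces to one term. *)
  have gE y' : g (x, y) (x', y') =
      a x' x / marginal a x' * marginal g (x', y').
    apply: (mulfI (lt0r_neq0 (cp_supp C x'))).
    rewrite mulrA [_ * (_ / _)]mulrC divfK ?lt0r_neq0 ?(cp_supp C) //.
    rewrite -(cp_left C).2 (cp_sym C); congr (_ * _).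
    rewrite [RHS](bigD1 y) //= [X in _ + X]big1 ?addr0 // => y2 y2y.
    rewrite (cp_sym C); apply: (kernel_supp_marginal _ (cp_ge0 C)).
    by apply: contraNeq y2y => r2; apply/eqP; apply: (cp_uniq C xM).
  under eq_bigr do rewrite gE mulrCA.
  by rewrite -mulr_sumr Y0 // mulr0.
have m0 x y : x \in M -> marginal (perturbation M idx jdx Y g) (x, y) = 0.
  by move=> xM; rewrite marginal_pair big1 // => x' _; apply: S0.
have mY x y : x \notin M -> marginal (perturbation M idx jdx Y g) (x, y) =
    Y (idx x) (jdx y) * marginal g (x, y).
  move=> xM; rewrite /marginal mulr_sumr; apply: eq_bigr => z _.
  by rewrite /perturbation /= xM.
split=> [x|x x' y]; have [xM|xM] := boolP (x \in M).
- by apply: big1 => y _; apply: m0.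
- by under eq_bigr do rewrite mY //; apply: Y0.
- by rewrite S0 // m0 // !mulr0.
- rewrite mY // /perturbation /= xM -mulr_sumr mulrCA (cp_left C).2.
  by rewrite mulrCA.
Qed.

End Perturbation.

Section Decomposition.
Variables (R : realType) (U I : finType) (a : U -> U -> R) (M : {set U}).
Variables (W : I -> finType) (a1 : forall i, W i -> W i -> R).
Variables (L : forall i, {set W i}) (pi : forall i, W i -> U) (mu : I -> R).
Arguments a1 : clear implicits.
Arguments pi : clear implicits.
Variable idx : U -> I.
Hypothesis A : decomposition a M a1 L pi mu idx.

Lemma decomposition_edge x x' : x \notin M -> x' \notin M -> a x x' != 0 ->
  idx x = idx x'.
Proof.
move=> xM xM'; have [u uL ux] := dec_surj A xM.
rewrite -[in a x]ux (piece_cov (dec_piece A _)) // => ax.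
have [v /eqP vx] : exists v, pi (idx x) v == x'.
  apply/existsP; apply: contraNT ax => /existsPn no.
  by rewrite big_pred0 ?mulr0 // => v; apply/negbTE/no.
rewrite -vx (dec_idx A) //.
by rewrite -(piece_in (dec_piece A _)) vx.
Qed.

End Decomposition.

Section PieceMasses.
Variables (R : realType) (U I : finType) (a : U -> U -> R) (M : {set U}).
Variables (W : I -> finType) (a1 : forall i, W i -> W i -> R).
Variables (L : forall i, {set W i}) (pi : forall i, W i -> U) (mu : I -> R).
Arguments a1 : clear implicits.
Arguments pi : clear implicits.
Variable idx : U -> I.
Hypothesis A : decomposition a M a1 L pi mu idx.
Variables (V J : finType) (b : V -> V -> R) (N : {set V}).
Variables (Z : J -> finType) (b1 : forall j, Z j -> Z j -> R).
Variables (K : forall j, {set Z j}) (rho : forall j, Z j -> V) (nu : J -> R).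
Arguments b1 : clear implicits.
Arguments rho : clear implicits.
Variable jdx : V -> J.
Hypothesis B : decomposition b N b1 K rho nu jdx.
Variable g : U * V -> U * V -> R.
Hypothesis C : compatible a b M N g.

Let res i j := restriction (a1 i) (b1 j) (pi i) (rho j) g.
Arguments res : clear implicits.
Let c i j := mass (res i j).

(** Outside [K j], the map [rho j] is a bijection onto the vertices of piece [j] off [N], so the sum
    is a first marginal of the restriction. *)
Lemma marginal_piece_mass i j u : u \notin L i ->
  \sum_(y | (y \notin N) && (jdx y == j)) marginal g (pi i u, y) =
  c i j * marginal (a1 i) u.
Proof.
move=> uL; have Ai := dec_piece A i; have Bj := dec_piece B j.
rewrite -(restriction_left Ai Bj C).1 (bigID (mem (K j))) /=.
rewrite [X in _ = X + _]big1 ?add0r => [|v vK]; last first.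
  apply: big1 => z _; apply: (restriction_mixed Ai Bj C).
  by rewrite (negPf uL) vK.
rewrite [RHS](partition_big (rho j)
  (fun y => (y \notin N) && (jdx y == j))) => [|v vK]; last first.
  by rewrite (piece_in Bj) vK (dec_idx B) //=.
apply: eq_bigr => y /andP[yN /eqP yj].
have [v vK vy] : exists2 v, v \notin K j & rho j v = y.
  by rewrite -yj; apply: (dec_surj B).
rewrite (bigD1 v) ?vK ?vy ?eqxx //= big1 ?addr0.
  by rewrite (restriction_marginal_inner Ai Bj C) // vy.
move=> w /andP[/andP[wK /eqP wy] /eqP[]].
by apply: (piece_inj Bj) => //; rewrite wy.
Qed.

Lemma marginal_sum_pieces i u (F : J -> R) : u \notin L i ->
  \sum_y F (jdx y) * marginal g (pi i u, y) =
  (\sum_j F j * c i j) * marginal (a1 i) u.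
Proof.
move=> uL; rewrite (bigID (mem N)) /= big1 ?add0r => [|y yN]; last first.
  have [->|/(cp_match C)] := eqVneq (marginal g (pi i u, y)) 0.
    by rewrite mulr0.
  by rewrite (piece_in (dec_piece A i)) yN (negPf uL).
rewrite (partition_big jdx xpredT) //= mulr_suml; apply: eq_bigr => j _.
rewrite -mulrA -marginal_piece_mass // mulr_sumr.
by apply: eq_bigr => y /andP[_ /eqP->].
Qed.

Lemma piece_mass_sum i : \sum_j c i j = mu i.
Proof.
have Ai := dec_piece A i; have [u uL] := piece_inner Ai.
apply: (mulIf (lt0r_neq0 (piece_supp Ai u))).
rewrite -(piece_marginal Ai uL) -(cp_left C).1.
have := marginal_sum_pieces (fun=> 1) uL.
under eq_bigr do rewrite mul1r.
by under [in X in _ = X -> _]eq_bigr do rewrite mul1r.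
Qed.

Lemma piece_mass_ge0 i j : 0 <= c i j.
Proof. exact: (mass_restriction_ge0 (a1 i) (pi i) (b1 j) (rho j) C). Qed.

Lemma piece_mass_gt0 i j u v : marginal (res i j) (u, v) != 0 -> 0 < c i j.
Proof.
move=> r0; rewrite lt_def piece_mass_ge0 andbT; apply: contraNneq r0 => c0.
have [ui _] := restriction_left (dec_piece A i) (dec_piece B j) C.
have /eqP := ui u; rewrite -/(res i j) -/(c i j) c0 mul0r.
rewrite psumr_eq0 => [/allP/(_ v (mem_index_enum _))//|w _].
by apply: marginal_ge0; apply: (restriction_ge0 _ _ _ _ C).
Qed.

(** Elements of [M] have one partner by compatibility. Elsewhere the first hypothesis determines the
    piece of the partner, and the second its place in that piece. *)
Lemma piece_bijective_left :
  (forall i j j', c i j != 0 -> c i j' != 0 -> j = j') ->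
  (forall i j u v v', marginal (res i j) (u, v) != 0 ->
     marginal (res i j) (u, v') != 0 -> v = v') ->
  forall x, exists! y, 0 < marginal g (x, y).
Proof.
move=> cj vj x.
have [y xy] : exists y, 0 < marginal g (x, y).
  have /lt0r_neq0/eqP := cp_supp C x; rewrite -(cp_left C).1 => /psumr_neq0P.
  by case=> [y _|y /= xy]; [apply: marginal_ge0; apply: (cp_ge0 C)|exists y].
exists y; split=> // y' xy'.
have [xM|xM] := boolP (x \in M).
  by apply: (cp_uniq C xM); apply: lt0r_neq0.
have yN : y \notin N by rewrite -(cp_match C (lt0r_neq0 xy)).
have yN' : y' \notin N by rewrite -(cp_match C (lt0r_neq0 xy')).
have [u uL ux] := dec_surj A xM.
have [v vK vy] := dec_surj B yN; have [v' vK' vy'] := dec_surj B yN'.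
have Ai := dec_piece A (idx x).
have rE j w : w \notin K j ->
    marginal (res (idx x) j) (u, w) = marginal g (x, rho j w).
  by move=> wK; rewrite (restriction_marginal_inner Ai (dec_piece B j) C) // ux.
have r1 : marginal (res (idx x) (jdx y)) (u, v) != 0.
  by rewrite rE // vy lt0r_neq0.
have r2 : marginal (res (idx x) (jdx y')) (u, v') != 0.
  by rewrite rE // vy' lt0r_neq0.
have jj : jdx y = jdx y'.
  by apply: (cj (idx x)); apply: lt0r_neq0;
    [exact: piece_mass_gt0 r1|exact: piece_mass_gt0 r2].
move: v' vK' vy' r2; rewrite -jj => v' vK' vy' r2.
by rewrite -vy -vy' (vj _ _ _ _ _ r1 r2).
Qed.

End PieceMasses.

Section RigidPieces.
Variables (R : realType) (U I : finType) (a : U -> U -> R) (M : {set U}).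
Variables (W : I -> finType) (a1 : forall i, W i -> W i -> R).
Variables (L : forall i, {set W i}) (pi : forall i, W i -> U) (mu : I -> R).
Arguments a1 : clear implicits.
Arguments pi : clear implicits.
Variable idx : U -> I.
Hypothesis A : decomposition a M a1 L pi mu idx.
Variables (V J : finType) (b : V -> V -> R) (N : {set V}).
Variables (Z : J -> finType) (b1 : forall j, Z j -> Z j -> R).
Variables (K : forall j, {set Z j}) (rho : forall j, Z j -> V) (nu : J -> R).
Arguments b1 : clear implicits.
Arguments rho : clear implicits.
Variable jdx : V -> J.
Hypothesis B : decomposition b N b1 K rho nu jdx.
Variable g : U * V -> U * V -> R.
Hypothesis C : compatible a b M N g.

Let res i j := restriction (a1 i) (b1 j) (pi i) (rho j) g.
Arguments res : clear implicits.
Let c i j := mass (res i j).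

Let c_flip i j :
  mass (restriction (b1 j) (a1 i) (rho j) (pi i) (flip g)) = c i j.
Proof. by rewrite -flip_restriction mass_flip. Qed.

Lemma piece_mass_sum_flip j : \sum_i c i j = nu j.
Proof.
rewrite -(piece_mass_sum B A (compatible_flip C)).
by apply: eq_bigr => i _; rewrite c_flip.
Qed.

(** The only ambiguity is for an edge with no end in [M]; its two ends lie over the same pair of
    pieces, hence have the same density. *)
Lemma perturbation_sym Y : symmetric_kernel (perturbation M idx jdx Y g).
Proof.
move=> [x y] [x' y']; rewrite /perturbation /= -(cp_sym C (x, y)).
have [->|gz] := eqVneq (g (x, y) (x', y')) 0; first by rewrite !mulr0.
congr (_ * _).
have xy := cp_match C (compatible_marginal C gz).
have ax : a x x' != 0.
  by apply: contraNneq gz => a0; rewrite (compatible_edge _ _ C a0).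
have by_ : b y y' != 0.
  apply: contraNneq gz => b0.
  apply/eqP/(compatible_edge x x' (compatible_flip C) b0).
rewrite (cp_sym C) in gz.
have xy' := cp_match C (compatible_marginal C gz).
case: (boolP (x \in M)) (boolP (x' \in M)) => [xM|xM] [xM'|xM'] //=.
rewrite (decomposition_edge A xM xM' ax).
have yN : y \notin N by rewrite -xy.
have yN' : y' \notin N by rewrite -xy'.
by rewrite (decomposition_edge B yN yN' by_).
Qed.

(** The quotient [X / c], zero where [c] is, serves as a density: the zero sums of [X] make the
    perturbation of [g] homogeneous, so it vanishes, and evaluating it at an inner pair shows that
    the density is zero. *)
Lemma piece_mass_rigid : rigid a b g -> forall X : I -> J -> R,
  (forall i, \sum_j X i j = 0) -> (forall j, \sum_i X i j = 0) ->
  (forall i j, c i j = 0 -> X i j = 0) -> forall i j, X i j = 0.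
Proof.
move=> gr X Xi Xj Xc; pose Y i j := X i j / c i j.
have YX i j : Y i j * c i j = X i j.
  rewrite /Y; have [c0|c0] := eqVneq (c i j) 0; last by rewrite divfK.
  by rewrite c0 mulr0 Xc.
have Y0 x : x \notin M -> \sum_y Y (idx x) (jdx y) * marginal g (x, y) = 0.
  move=> xM; have [u uL <-] := dec_surj A xM; rewrite (dec_idx A) //.
  rewrite (marginal_sum_pieces A B C _ uL); under eq_bigr do rewrite YX.
  by rewrite Xi mul0r.
have Y0' y : y \notin N ->
    \sum_x Y (idx x) (jdx y) * marginal (flip g) (y, x) = 0.
  move=> yN; have [v vK <-] := dec_surj B yN; rewrite (dec_idx B) //.
  rewrite (marginal_sum_pieces B A (compatible_flip C) (fun i => Y i (jdx y)) vK).
  by under eq_bigr do rewrite c_flip YX; rewrite Xj mul0r.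
have p0 : forall z z', perturbation M idx jdx Y g z z' = 0.
  apply: gr; last by move=> z z' gz; rewrite /perturbation gz mulr0.
  split; first exact: perturbation_sym.
    exact: (perturbation_left C Y0).
  rewrite (flip_perturbation C); exact: (perturbation_left (compatible_flip C) Y0').
move=> i j; have [/Xc//|c0] := eqVneq (c i j) 0.
have cp : 0 < c i j by rewrite lt_def c0; apply: (piece_mass_ge0 a1 pi b1 rho C).
have [u [v [uL vK r0]]] :=
  restriction_mass_inner (dec_piece A i) (dec_piece B j) C cp.
have [z gz] : exists z, g (pi i u, rho j v) z != 0.
  apply: contrapT => no; move/eqP: r0; apply; apply: big1 => z _.
  by apply/eqP; apply: contraT => gz; case: no; exists z.
have /eqP := p0 (pi i u, rho j v) z.
rewrite /perturbation /= (piece_in (dec_piece A i)) uL.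
rewrite (dec_idx A) // (dec_idx B) // mulf_eq0 (negPf gz) orbF => /eqP Yij.
by rewrite -YX Yij mul0r.
Qed.

Lemma rigid_pieces_bijective : rigid a b g ->
  (forall i j, c i j != 0 -> mu i = nu j) ->
  (forall i j u v v', marginal (res i j) (u, v) != 0 ->
     marginal (res i j) (u, v') != 0 -> v = v') ->
  (forall i j v u u', marginal (res i j) (u, v) != 0 ->
     marginal (res i j) (u', v) != 0 -> u = u') ->
  bijective_joining g.
Proof.
move=> gr mn rv ru; have cr := piece_mass_rigid gr.
have c0 i j : 0 <= c i j by apply: (piece_mass_ge0 a1 pi b1 rho C).
have ci := piece_mass_sum A B C; have cj := piece_mass_sum_flip.
split.
  apply: (piece_bijective_left A B C) => // i j j'.
  exact: (rigid_matrix_row_inj c0 ci cj mn cr).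
move=> v.
have [|j i v1|u [uv uq]] :=
    piece_bijective_left B A (compatible_flip C) _ _ v.
- move=> j i i'; rewrite !c_flip.
  apply: (@rigid_matrix_row_inj _ _ _ (fun j i => c i j) nu mu) => //.
    by move=> j' i2 /mn.
  move=> X Xi Xj Xc j2 i2; apply: (cr (fun i j => X j i)) => //.
  by move=> *; apply: Xc.
- by move=> u u'; rewrite -flip_restriction !marginal_flip; apply: ru.
- exists u; split; first by rewrite -marginal_flip.
  by move=> u'; rewrite -marginal_flip; apply: uq.
Qed.

End RigidPieces.

(** * Gluings as decompositions *)

Lemma leaf_base (R : realType) (P : Type) (G : graph R P) (l : G) :
  is_leaf l -> forall x, (0 < weight l x) = (x == base l).
Proof.
move=> [b bl lb]; suff -> : base l = b by move=> x; apply/idP/eqP => /lb.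
rewrite /base; case: pickP => [x /andP[_ /lb->]//|/(_ b)].
by rewrite bl (lb b).2.
Qed.

(* Otherwise the leaf and its base would form a whole connected component. *)
Lemma base_inner (R : realType) (P : Type) (G : graph R P) (L : {set G}) (l : G) :
  connected_graph G -> (forall l, l \in L -> is_leaf l) ->
  (exists u, u \notin L) -> l \in L -> base l \notin L.
Proof.
move=> conn leafL [u uL] lL; apply/negP => bL.
have [_ ws _] := weightP G.
have lb := leaf_base (leafL _ lL); have bb := leaf_base (leafL _ bL).
have blE : base (base l) = l by apply/esym/eqP; rewrite -bb ws lb.
rewrite blE in bb.
have cl : closed (fun x y : G => 0 < weight x y) [pred x | (x == l) || (x == base l)].
  move=> x y xy; rewrite !inE; apply/idP/idP => /orP[]/eqP E.
  - by move: xy; rewrite E lb => ->; rewrite orbT.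
  - by move: xy; rewrite E bb => ->.
  - by move: xy; rewrite E ws lb => ->; rewrite orbT.
  - by move: xy; rewrite E ws bb => ->.
have := closed_connect cl (conn l u); rewrite !inE eqxx /= => /esym/orP[]/eqP E.
  by rewrite E lL in uL.
by rewrite E bL in uL.
Qed.

Definition glue_map (R : realType) (Q : Type) (U : finType) (k : nat)
    (Gs : 'I_k -> graph R Q) (L : forall i, {set Gs i})
    (e f : forall i, Gs i -> U) (i : 'I_k) (u : Gs i) : U :=
  if u \in L i then f i u else e i u.
Arguments glue_map {R Q U k Gs} L e f i u.

Lemma gluing_decomposition (R : realType) (P Q : Type) (G : graph R P)
    (k : nat) (Gs : 'I_k -> graph R Q) (M : {set G}) (L : forall i, {set Gs i})
    (e f : forall i, Gs i -> G) (mu : 'I_k -> R) :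
  (0 < k)%N -> (forall i, fully_supported (Gs i)) -> is_gluing M L e f mu ->
  exists idx, decomposition (@weight R P G) M (fun i => @weight R Q (Gs i))
    L (glue_map L e f) mu idx.
Proof.
move=> k0 supp [conn Lprop bij mu0 [tau [part [tau0 tauM partP wE]]]].
have [eM einj esurj] := bij.
have eM' i (u : Gs i) : u \notin L i -> e i u \notin M.
  by move=> uL; have := eM (Tagged (fun i => Gs i) u) uL.
have einj' i j (u : Gs i) (v : Gs j) : u \notin L i -> v \notin L j ->
    e i u = e j v -> Tagged (fun i => Gs i) u = Tagged (fun i => Gs i) v.
  by move=> uL vL uv; apply: einj => //; rewrite inE.
have einj1 i (u v : Gs i) : u \notin L i -> v \notin L i -> e i u = e i v -> u = v.
  move=> uL vL /(einj' _ _ _ _ uL vL) /eqP.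
  by rewrite eq_Tagged => /eqP.
have fM i l : l \in L i -> f i l \in M by case: (Lprop i) => _ _ + _; apply.
have bL i l : l \in L i -> base l \notin L i.
  by case: (Lprop i) => leafL ne _ _; apply: base_inner.
have lb i l : l \in L i -> forall x : Gs i, (0 < weight l x) = (x == base l).
  by case: (Lprop i) => leafL _ _ _ /leafL /leaf_base.
have piM i u : (glue_map L e f i u \in M) = (u \in L i).
  rewrite /glue_map; case: ifP => uL; first exact: fM.
  by apply/negbTE/eM'; rewrite uL.
(* Elements of [M] receive a dummy index, available since [0 < k]. *)
have idxP x : exists i, x \notin M -> exists2 u : Gs i, u \notin L i & e i u = x.
  have [xM|xM] := boolP (x \in M); first by exists (Ordinal k0).
  by have [[i u] uL <-] := esurj x xM; exists i => _; exists u.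
have [idx idxE] := choice idxP; exists idx.
have w0 i (u v : Gs i) : (0 < weight u v) = false -> weight u v = 0.
  by have [ge0 _ _] := weightP (Gs i); rewrite lt_def ge0 andbT => /negbFE/eqP.
have other i j (u : Gs i) x : u \notin L i -> j != i -> part j (e i u) x = 0.
  move=> uL ji; have [_ _ p0] := partP j; apply: p0.
    move=> [v [v' [vL _ /(einj' _ _ _ _ uL vL)/(congr1 tag)/= ij _]]].
    by rewrite ij eqxx in ji.
  move=> [l [lL [[E _]|[E _]]]].
    have /(congr1 tag)/= ij := einj' _ _ _ _ uL (bL _ _ lL) E.
    by rewrite ij eqxx in ji.
  by have := eM' _ _ uL; rewrite E fM.
(* At most one neighbour [v] of [u] lies over [x]: inner vertices embed injectively, and leaves with
   the same base [u] go to distinct elements of [M]. *)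
have own i (u : Gs i) x : u \notin L i ->
    part i (e i u) x = \sum_(v | glue_map L e f i v == x) weight u v.
  move=> uL; have [pin pleaf p0] := partP i.
  have [v /andP[uv /eqP vx]|no] :=
    pickP [pred v : Gs i | (0 < weight u v) && (glue_map L e f i v == x)].
    rewrite (bigD1 v) /= ?vx // big1 ?addr0.
      move: vx; rewrite /glue_map; case: ifP => [vL <-|vL <-]; last first.
        by rewrite pin ?vL.
      have [_ ws _] := weightP (Gs i).
      have ub : u = base v by apply/eqP; rewrite -(lb _ _ vL) ws.
      by rewrite ub; apply: (pleaf v vL).1.
    move=> v' /andP[/eqP vx' ne]; apply/w0/negbTE; apply: contra ne => uv'.
    have vv : (v' \in L i) = (v \in L i) by rewrite -!piM vx vx'.
    move: vx vx'; rewrite /glue_map vv; case: ifP => vL <- E.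
      have [_ ws _] := weightP (Gs i).
      have ub : base v = u by apply/esym/eqP; rewrite -(lb _ _ vL) ws.
      have ub' : base v' = u by apply/esym/eqP; rewrite -lb ?vv // ws.
      have [_ _ _ finj] := Lprop i; apply: contraT => ne.
      have vL' : v' \in L i by rewrite vv.
      by have := finj _ _ vL' vL ne (etrans ub' (esym ub)); rewrite E eqxx.
    by apply/eqP/(einj1 i) => //; rewrite ?vv vL.
  rewrite big1 => [|v vx]; last first.
    by apply: w0; have := no v; rewrite /= vx andbT.
  have [[v [vL vx]]|nov] := EM (exists v : Gs i, v \notin L i /\ e i v = x).
    rewrite -vx pin //; apply: w0; have := no v.
    by rewrite /= /glue_map (negPf vL) vx eqxx andbT.
  apply: p0 => [[u1 [v [_ vL _ vx]]]|]; first by apply: nov; exists v.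
  move=> [l [lL [[E xE]|[E _]]]]; last by have := eM' _ _ uL; rewrite E fM.
  have ub := einj1 _ _ _ uL (bL _ _ lL) E.
  have := no l; rewrite /= /glue_map lL xE eqxx andbT.
  have [_ ws _] := weightP (Gs i).
  by rewrite ub ws lb // eqxx.
split.
- move=> i; split=> //.
  + exact: weightP.
  + exact: supp.
  + exact: conn.
  + move=> u v uL uv; have vL : v \notin L i by rewrite -piM -uv piM.
    by move: uv; rewrite /glue_map (negPf uL) (negPf vL); apply: einj1.
  + move=> u x uL; rewrite {1}/glue_map (negPf uL) wE.
    have -> : tau (e i u) x = 0.
      apply/eqP; apply: contraT => /tauM[uM _].
      by have := eM' _ _ uL; rewrite uM.
    rewrite add0r (bigD1 i) //= big1 ?addr0 => [|j ji]; last first.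
      by rewrite other // mulr0.
    by rewrite own.
  + move=> u v v' uv uv' E.
    have vv : (v' \in L i) = (v \in L i) by rewrite -!piM E.
    have [vL|vL] := boolP (v \in L i); last first.
      by move: E; rewrite /glue_map vv (negPf vL); apply: einj1; rewrite ?vv.
    have [_ ws _] := weightP (Gs i).
    have ub : base v = u by apply/esym/eqP; rewrite -(lb _ _ vL) ws.
    have ub' : base v' = u by apply/esym/eqP; rewrite -lb ?vv // ws.
    have [_ _ _ finj] := Lprop i; apply/eqP; apply: contraT => ne.
    have vL' : v' \in L i by rewrite vv.
    have := finj _ _ vL vL' ne (etrans ub (esym ub')).
    by move: E; rewrite /glue_map vL vL' => ->; rewrite eqxx.
  + by move=> l lL; exists (base l); [exact: bL|exact: lb].
  + by have [_ ? _ _] := Lprop i.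
- move=> i u uL; have := idxE (e i u) (eM' _ _ uL).
  rewrite /glue_map (negPf uL) => -[v vL /(einj' _ _ _ _ vL uL)].
  by move=> /(congr1 tag).
- move=> x xM; have [u uL ux] := idxE x xM.
  by exists u => //; rewrite /glue_map (negPf uL).
Qed.

(** * Magic decompositions *)

Lemma rigid_scale (R : realType) (U V : finType) (a : U -> U -> R)
    (b : V -> V -> R) (g : U * V -> U * V -> R) t :
  rigid a b g -> t != 0 -> rigid a b (fun x y => t * g x y).
Proof.
move=> gr t0 d hd td; apply: gr => // x y gxy.
by apply: td; rewrite gxy mulr0.
Qed.

Section Magic.
Variables (R : realType) (PG SG PF SF : eqType).
Variables (famG : graph_family R PG) (famF : graph_family R PF).
Variables (Psi : scheme R PG SG) (PsiT : scheme R PF SF).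
Hypotheses (hGsupp : forall G : graph R PG, famG G -> fully_supported G)
  (hFsupp : forall G : graph R PF, famF G -> fully_supported G).
Hypothesis hmagic : has_magic_decomposition famF PsiT famG Psi.
Hypotheses (hdetect : detects_isomorphism famG Psi)
  (hidentify : identifies_isomorphism famG Psi).

Lemma rigid_zero_cost_bijective (G H : graph R PF) (g : G * H -> G * H -> R) :
  famF G -> famF H -> joinings G H g -> joining_cost PsiT g = 0 ->
  rigid (@weight R PF G) (@weight R PF H) g -> bijective_joining g.
Proof.
move=> FG FH gJ gc gr; have [g0 gs ga gb] := (joiningP _).1 gJ.
have lab x y : marginal g (x, y) != 0 -> aug_label PsiT x = aug_label PsiT y.
  by move=> /((zero_costP PsiT g0).1 gc).
move: hmagic => [Lstar [eta [eta' [omega [_ dec]]]]].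
have [k [Gs [M [L [e [f [mu [k0 FGs glu
  [[Ms Mo] Minj etaE etaE' omE]]]]]]]]] := dec G FG.
have [m [Hs [N [K [e' [f' [nu [m0 FHs glu'
  [[Ns No] Ninj etaH etaH' omH]]]]]]]]] := dec H FH.
have [idx A] := gluing_decomposition k0 (fun i => hGsupp (FGs i)) glu.
have [jdx B] := gluing_decomposition m0 (fun j => hGsupp (FHs j)) glu'.
have C : compatible (@weight R PF G) (@weight R PF H) M N g.
  have mt x y : marginal g (x, y) != 0 -> (x \in M) = (y \in N).
    move=> /lab xy.
    have [xM|xM] := boolP (x \in M); have [yN|yN] := boolP (y \in N) => //.
      by case: (No _ yN); rewrite -xy; apply: Ms.
    by case: (Mo _ xM); rewrite xy; apply: Ns.
  split=> //; try exact: hFsupp.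
  - by case: (weightP G).
  - by case: (weightP H).
  - move=> x y y' xM xy xy'; apply: Ninj; rewrite -?(mt x) //.
    by rewrite -(lab _ _ xy) (lab _ _ xy').
  - move=> y x x' yN; rewrite !marginal_flip => xy xy'.
    by apply: Minj; rewrite ?(mt _ y) // (lab _ _ xy) (lab _ _ xy').
pose res i j := restriction (@weight R PG (Gs i)) (@weight R PG (Hs j))
  (glue_map L e f i) (glue_map K e' f' j) g.
(* Labels of the glued graphs agree at both ends of an edge of [g]. One end determines the label of
   an inner vertex through [eta]; for a leaf, [eta'] uses both ends, the other one being the
   base. *)
have resS i j (u : Gs i) (v : Hs j) : marginal (res i j) (u, v) != 0 ->
    aug_label Psi u = aug_label Psi v.
  move=> ruv; have Ai := dec_piece A i; have Bj := dec_piece B j.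
  have [[u' v'] rz] : exists z, res i j (u, v) z != 0.
    apply: contrapT => no; move/eqP: ruv; apply; apply: big1 => z _.
    by apply/eqP; apply: contraT => rz; case: no; exists z.
  have [uu vv uvK] := restriction_edge Ai Bj C rz.
  have gz : g (glue_map L e f i u, glue_map K e' f' j v)
      (glue_map L e f i u', glue_map K e' f' j v') != 0.
    by move: rz; rewrite /res /restriction /= uu vv.
  have /lab l1 := compatible_marginal C gz.
  rewrite (cp_sym C) in gz; have /lab := compatible_marginal C gz.
  move: l1; rewrite /glue_map uvK; have [uL|uL] := boolP (u \in L i); last first.
    by rewrite etaE // etaH ?uvK // => ->.
  have vK : v \in K j by rewrite uvK.
  rewrite (negPf (piece_leaf_nbr Ai uL uu)) (negPf (piece_leaf_nbr Bj vK vv)).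
  have [_ Lp _ _ _] := glu; have [Ll _ _ _] := Lp i.
  have [_ Kp _ _ _] := glu'; have [Kl _ _ _] := Kp j.
  have -> : u' = base u by apply/eqP; rewrite -(leaf_base (Ll _ uL)).
  have -> : v' = base v by apply/eqP; rewrite -(leaf_base (Kl _ vK)).
  by rewrite etaE' // etaH' // => -> ->.
have bij i j : mass (res i j) != 0 -> bijective_joining (res i j).
  move=> c0; have Ai := dec_piece A i; have Bj := dec_piece B j.
  have cp : 0 < mass (res i j).
    by rewrite lt_def c0; apply: (mass_restriction_ge0 _ _ _ _ C).
  have hJ := restriction_joining Ai Bj C cp.
  set h := fun z z' => _ in hJ.
  have [h0 _ _ _] := (joiningP (G := Gs i) (H := Hs j) h).1 hJ.
  have hm z : marginal h z = (mass (res i j))^-1 * marginal (res i j) z.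
    exact: marginal_scale.
  have hc : joining_cost Psi (G := Gs i) (H := Hs j) h = 0.
    apply/(zero_costP Psi h0) => -[u v]; rewrite hm mulf_eq0 negb_or.
    by move=> /andP[_ /resS].
  have cost0 := OGJ_cost_eq0 (G := Gs i) (H := Hs j) hJ hc.
  (* Detection makes the two pieces isomorphic, as required to apply identification to the extreme
     point [h]. *)
  have iso := (hdetect (FGs i) (FHs j)).1 cost0.
  have hr : rigid (@weight R PG (Gs i)) (@weight R PG (Hs j)) h.
    apply: rigid_scale; last by rewrite invr_eq0.
    exact: (restriction_rigid Ai Bj C gr).
  have := (extreme_optimal_rigid (G := Gs i) (H := Hs j) cost0 hJ hc).2 hr.
  rewrite (hidentify (FGs i) (FHs j) iso) => -[_ _ [b1 b2]].
  have hE z : (0 < marginal h z) = (0 < marginal (res i j) z).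
    by rewrite hm pmulr_rgt0 ?invr_gt0.
  split=> [u|v].
    have [v [uv vq]] := b1 u; exists v; split; first by rewrite -hE.
    by move=> v'; rewrite -hE; apply: vq.
  have [u [uv uq]] := b2 v; exists u; split; first by rewrite -hE.
  by move=> u'; rewrite -hE; apply: uq.
have rp i j z : marginal (res i j) z != 0 -> 0 < marginal (res i j) z.
  move=> rz; rewrite lt_def rz marginal_ge0 // => x y.
  exact: (restriction_ge0 _ _ _ _ C).
have cne i j u v : marginal (res i j) (u, v) != 0 -> mass (res i j) != 0.
  by move=> /(piece_mass_gt0 A B C)/lt0r_neq0.
apply: (rigid_pieces_bijective A B C gr) => i j.
(* At an inner pair of nonzero mass the labels agree, and [omega] of this label is both [mu i] and
   [nu j]. *)
- move=> c0; have cp : 0 < mass (res i j).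
    by rewrite lt_def c0; apply: (mass_restriction_ge0 _ _ _ _ C).
  have [u [v [uL vK /lab]]] :=
    restriction_mass_inner (dec_piece A i) (dec_piece B j) C cp.
  by rewrite /glue_map (negPf uL) (negPf vK) -(omE i u) // -(omH j v) // => ->.
- move=> u v v' r1 r2; have [b1 _] := bij _ _ (cne _ _ _ _ r1).
  have [w [_ wq]] := b1 u.
  by rewrite -(wq v (rp _ _ _ r1)) -(wq v' (rp _ _ _ r2)).
- move=> v u u' r1 r2; have [_ b2] := bij _ _ (cne _ _ _ _ r1).
  have [w [_ wq]] := b2 v.
  by rewrite -(wq u (rp _ _ _ r1)) -(wq u' (rp _ _ _ r2)).
Qed.

End Magic.

Theorem theorem4p9 (R : realType) (PG SG PF SF : eqType)
    (famG : graph_family R PG) (famF : graph_family R PF)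
    (Psi : scheme R PG SG) (PsiT : scheme R PF SF)
    (hGsupp : forall G : graph R PG, famG G -> fully_supported G)
    (hFsupp : forall G : graph R PF, famF G -> fully_supported G)
    (hPsi : iso_invariant famG Psi)
    (hPsiT : iso_invariant famF PsiT)
    (hmagic : has_magic_decomposition famF PsiT famG Psi)
    (hdetect : detects_isomorphism famG Psi)
    (hidentify : identifies_isomorphism famG Psi) :
  detects_isomorphism famF PsiT /\ identifies_isomorphism famF PsiT.
Proof.
have bij := rigid_zero_cost_bijective hGsupp hFsupp hmagic hdetect hidentify.
have cost0 G H : famF G -> famF H -> isomorphic G H -> OGJ_cost PsiT G H = 0.
  move=> FG FH [f fiso].
  have [g [gJ g0]] := iso_zero_cost fiso (hPsiT _ _ _ FG FH fiso).
  exact: OGJ_cost_eq0 gJ g0.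
split=> G H FG FH.
  split; last exact: cost0.
  move=> /OGJ_cost_rigid[g [gJ gr g0]].
  exact: (bijective_joining_iso (hFsupp _ FG) (hFsupp _ FH) gJ g0 (bij _ _ _ FG FH gJ g0 gr)).
move=> iso; have c0 := cost0 G H FG FH iso.
apply/seteqP; split=> g /=.
  move=> ext; have [gJ gc] := ext.1; rewrite c0 in gc.
  split=> //; apply: (bij _ _ _ FG FH gJ gc).
  exact: (extreme_optimal_rigid c0 gJ gc).1.
move=> [gJ gc gb]; apply/(extreme_optimal_rigid c0 gJ gc).
exact: bijective_joining_rigid (hFsupp _ FG) gJ gb.
Qed.
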